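(* Let $\mathcal{L}\in \mathrm{Mat}_d(\mathbb{Z})$ have no non-trivial invariant subspace over $\mathbb{Q}$ and let $k=|\det \mathcal{L}|$. Then there are constants $D_2,\sigma_2>0$ depending only on $d$ and $k$ such that $$|A+\mathcal{L} A| \geq (1+k^{1/d})^d|A|-D_2|A|^{1-\sigma_2}$$ for all finite $A\subset \mathbb{Z}^d$.
   Context: A non-trivial invariant subspace of $\mathcal{L}$ over $\mathbb{Q}$ is a subspace $W\subseteq\mathbb{Q}^d$ with $W\ne\{0\},\mathbb{Q}^d$ and $\mathcal{L}W\subseteq W$. *)

(* Defs.v *)
From HB Require Import structures.
From mathcomp Require Import all_boot all_order all_algebra.
From mathcomp Require Import finmap.
From mathcomp Require Import all_classical all_reals all_analysis.
Set Implicit Arguments. Unset Strict Implicit. Unset Printing Implicit Defensive.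
Import Order.TTheory GRing.Theory Num.Theory.
Local Open Scope ring_scope.
Local Open Scope fset_scope.

Definition matQ d (L : 'M[int]_d) : 'M[rat]_d := map_mx (fun z : int => z%:~R) L.

Definition inv_subspace d (L : 'M[int]_d) (W : {vspace 'cV[rat]_d}) : Prop :=
  forall v, v \in W -> matQ L *m v \in W.

Definition has_nontrivial_inv_subspace d (L : 'M[int]_d) : Prop :=
  exists W : {vspace 'cV[rat]_d}, [/\ W != 0%VS, W != fullv & inv_subspace L W].

Definition sum_dil d (L : 'M[int]_d) (A : {fset 'cV[int]_d}) : {fset 'cV[int]_d} :=
  [fset (a + L *m b)%R | a in A, b in A].

(* Main.v *)
(* Write c = (1 + k^(1/d))^d, N = |A| and D = A - A, and suppose |A + LA| < cN.

   Long lines.  By the Plunnecke inequality all sets nD + A have size O(N), so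
   2D is covered by boundedly many translates of D.  Doubling an element
   repeatedly and recording the translates used, the pigeonhole principle gives
   t <> 0 with t, 2t, 4t, ... in 2D up to a power of N; since nD grows only
   polynomially in n, covering A by lines parallel to t takes only O(N^(1-s))
   lines.  The same holds for Lt, ..., L^(d-1) t, and these vectors are
   independent because L has no invariant subspace.

   Brunn-Minkowski.  In the coordinates given by these directions a discrete
   Brunn-Minkowski inequality holds up to the number of lines.  Hence
   |X + LA| >= (|X|^(1/d) + N^(1/d))^d - O(N^(1-s)) for nonempty X in A.

   Induction on N.  A + LA is the disjoint union of the sets A_r + LA, where A_r
   are the parts of A in the k cosets of L Z^d.  If all A_r are nonempty, the
   defect cN - |A + LA| is at most O(N^(1-s)) plus min(Cy, T - y), where T is
   the sum of the defects of the large A_r and y measures the imbalance of the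
   sizes; so it is at most a fraction C/(C+1) < 1 of T, and this gain absorbs the
   loss from the concavity of n^(1-sigma).  In general, passing to the lattice
   generated by A - A under L, either some coset contributes an extra positive
   proportion of N, or every A_r = r + L B_r has B_r meeting all cosets and the
   previous case applies to each B_r. *)

Require Import Defs.
From HB Require Import structures.
From mathcomp Require Import all_boot all_order all_algebra.
From mathcomp Require Import finmap.
From mathcomp Require Import all_classical all_reals all_analysis.
From mathcomp Require Import zify ring lra.
Import Order.TTheory GRing.Theory Num.Theory.
Set Implicit Arguments. Unset Strict Implicit. Unset Printing Implicit Defensive.

Local Open Scope fset_scope.
Local Open Scope ring_scope.

(** * Minimisers and cardinalities of finite sets *)

Lemma seq_argmin (T : eqType) (disp : Order.disp_t) (O : orderType disp)
    (f : T -> O) (s : seq T) x0 : x0 \in s ->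
  exists2 x, x \in s & forall y, y \in s -> (f x <= f y)%O.
Proof.
elim: s x0 => // a s IH x0 _; case: s IH => [|b s] IH.
  by exists a => [|y]; rewrite ?mem_head // inE => /eqP->.
have [x xs xmin] := IH b (mem_head _ _).
have [le_ax|lt_xa] := leP (f a) (f x).
  exists a => [|y]; first exact: mem_head.
  by rewrite inE => /predU1P[->//|/xmin]; apply: le_trans.
exists x => [|y]; first by rewrite inE xs orbT.
by rewrite inE => /predU1P[->|/xmin//]; apply: ltW.
Qed.

Lemma card_fset_inj (T T' : choiceType) (f : T -> T') (A : {fset T}) (B : {fset T'}) :
  {in A &, injective f} -> (forall x, x \in A -> f x \in B) -> (#|` A| <= #|` B|)%N.
Proof.
move=> f_inj fB; have /= <- := card_in_imfset imfset_key f_inj.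
by apply/fsubset_leq_card/fsubsetP => _ /imfsetP[x xA ->]; apply: fB.
Qed.

Lemma card_inj_imfset (T T' : choiceType) (f : T -> T') (A : {fset T}) :
  injective f -> #|` f @` A| = #|` A|.
Proof. by move=> f_inj; rewrite card_imfset. Qed.

Lemma card_fsetM (T T' : choiceType) (A : {fset T}) (B : {fset T'}) :
  #|` A `*` B| = (#|` A| * #|` B|)%N.
Proof.
rewrite /fsetM (perm_size (enum_imfset2 _ _)) /= ?size_allpairs //.
by move=> [x y] [x' y'] _ _ /= [-> ->].
Qed.

(** * Sumsets *)

Section Sumsets.
Variable V : zmodType.
Implicit Types (A B C X Y : {fset V}).

Definition sumset A B : {fset V} := [fset (a + b)%R | a in A, b in B].
Definition oppset A : {fset V} := [fset - a | a in A].
Definition diffset A : {fset V} := sumset A (oppset A).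
Definition nfold n A : {fset V} := iter n (sumset A) [fset 0].

Lemma sumsetP A B x :
  reflect (exists a b, [/\ a \in A, b \in B & x = a + b]) (x \in sumset A B).
Proof.
apply: (iffP (imfset2P _ _ _ _ _)) => [[a aA [b bB ->]]|[a [b [aA bB ->]]]].
  by exists a, b.
by exists a => //; exists b.
Qed.

Lemma mem_sumset A B a b : a \in A -> b \in B -> a + b \in sumset A B.
Proof. by move=> aA bB; apply/sumsetP; exists a, b. Qed.

Lemma mem_oppset A x : (x \in oppset A) = (- x \in A).
Proof.
apply/imfsetP/idP => [[a aA ->]|xA]; first by rewrite opprK.
by exists (- x); rewrite ?opprK.
Qed.

Lemma sumsetC A B : sumset A B = sumset B A.
Proof.
by apply/fsetP => x; apply/sumsetP/sumsetP => -[a [b [aA bB ->]]];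
  exists b, a; rewrite addrC.
Qed.

Lemma sumsetA A B C : sumset A (sumset B C) = sumset (sumset A B) C.
Proof.
apply/fsetP => x; apply/sumsetP/sumsetP.
  move=> [a [y [aA /sumsetP[b [c [bB cC ->]]] ->]]].
  by exists (a + b), c; rewrite addrA mem_sumset.
move=> [y [c [/sumsetP[a [b [aA bB ->]]] cC ->]]].
by exists a, (b + c); rewrite addrA mem_sumset.
Qed.

Lemma sumsetS A B X Y : A `<=` X -> B `<=` Y -> sumset A B `<=` sumset X Y.
Proof.
move=> /fsubsetP AX /fsubsetP BY; apply/fsubsetP => x /sumsetP[a [b [aA bB ->]]].
by rewrite mem_sumset ?AX ?BY.
Qed.

Lemma sumset0 A : sumset A [fset 0] = A.
Proof.
apply/fsetP => x; apply/sumsetP/idP => [[a [b [aA /fset1P-> ->]]]|xA].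
  by rewrite addr0.
by exists x, 0; rewrite addr0 fset11.
Qed.

Lemma sumset0l A : sumset [fset 0] A = A.
Proof. by rewrite sumsetC sumset0. Qed.

Lemma sumsetAC A B C : sumset (sumset A B) C = sumset (sumset A C) B.
Proof. by rewrite -!sumsetA (sumsetC B). Qed.

Lemma sumsetACA A B C X :
  sumset (sumset A B) (sumset C X) = sumset (sumset A C) (sumset B X).
Proof. by rewrite sumsetA (sumsetAC A B C) -sumsetA. Qed.

Lemma sumset_fset0 A : sumset A fset0 = fset0.
Proof. by apply/fsetP => x; apply/sumsetP; rewrite in_fset0 => -[a [b []]]. Qed.

Lemma card_translate x A : #|` sumset [fset x] A| = #|` A|.
Proof.
have -> : sumset [fset x] A = [fset x + a | a in A].
  apply/fsetP => y; apply/sumsetP/imfsetP => [[a [b [/fset1P-> bB ->]]]|[a /= aA ->]].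
    by exists b.
  by exists x, a; rewrite fset11.
by rewrite card_imfset //; apply: addrI.
Qed.

Lemma card_sumset A B : (#|` sumset A B| <= #|` A| * #|` B|)%N.
Proof.
rewrite -card_fsetM; apply: (@leq_trans #|` [fset p.1 + p.2 | p in A `*` B]|).
  apply/fsubset_leq_card/fsubsetP => _ /sumsetP[a [b [aA bB ->]]].
  by apply/imfsetP; exists (a, b); rewrite //= in_fsetM aA.
exact: leq_imfset_card.
Qed.

Lemma card_sumsetS A B C : B `<=` C -> (#|` sumset A B| <= #|` sumset A C|)%N.
Proof. by move=> BC; apply/fsubset_leq_card/sumsetS. Qed.

Lemma card_sumset_ge A B b : b \in B -> (#|` A| <= #|` sumset A B|)%N.
Proof.
move=> bB; rewrite -(card_translate b) sumsetC.
by apply: card_sumsetS; rewrite fsub1set.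
Qed.

Lemma sumsetUr A B C : sumset A (B `|` C) = sumset A B `|` sumset A C.
Proof.
apply/eqP; rewrite eqEfsubset; apply/andP; split.
  apply/fsubsetP => x /sumsetP[a [b [aA /fsetUP[bB|bC] ->]]]; rewrite in_fsetU.
    by rewrite mem_sumset.
  by rewrite (mem_sumset aA bC) orbT.
by rewrite fsubUset !sumsetS ?fsubsetUl ?fsubsetUr.
Qed.

Lemma oppset_sumset A B : oppset (sumset A B) = sumset (oppset A) (oppset B).
Proof.
apply/fsetP => x; rewrite mem_oppset; apply/sumsetP/sumsetP.
  move=> [a [b [aA bB e]]]; exists (- a), (- b); rewrite !mem_oppset !opprK aA bB.
  by rewrite -opprD -e opprK.
move=> [a [b []]]; rewrite !mem_oppset => aA bB ->.
by exists (- a), (- b); rewrite opprD.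
Qed.

Lemma nfold1 A : nfold 1 A = A.
Proof. by rewrite /nfold /= sumset0. Qed.

Lemma nfoldS n A : nfold n.+1 A = sumset A (nfold n A).
Proof. by []. Qed.

Lemma nfoldD m n A : nfold (m + n) A = sumset (nfold m A) (nfold n A).
Proof.
elim: m => [|m IH]; first by rewrite add0n /nfold /= sumset0l.
by rewrite addSn !nfoldS IH sumsetA.
Qed.

Lemma nfold_sumset n A B : nfold n (sumset A B) = sumset (nfold n A) (nfold n B).
Proof.
elim: n => [|n IH]; first by rewrite /nfold /= sumset0.
by rewrite !nfoldS IH sumsetACA.
Qed.

Lemma oppset_nfold n A : oppset (nfold n A) = nfold n (oppset A).
Proof.
elim: n => [|n IH].
  by apply/fsetP => x; rewrite mem_oppset /nfold /= !inE oppr_eq0.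
by rewrite !nfoldS oppset_sumset IH.
Qed.

Lemma nfoldSS n A B : A `<=` B -> nfold n A `<=` nfold n B.
Proof. by move=> AB; elim: n => [|n IH] //; rewrite !nfoldS sumsetS. Qed.

Lemma nfold_mem0 n A : 0 \in A -> 0 \in nfold n A.
Proof.
move=> A0; elim: n => [|n IH]; first by rewrite inE.
by rewrite nfoldS -[0]addr0 mem_sumset.
Qed.

Lemma diffset_mem0 A : A != fset0 -> 0 \in diffset A.
Proof.
move=> /fset0Pn[a aA]; rewrite -(subrr a) mem_sumset // mem_oppset opprK //.
Qed.

Lemma oppset_diffset A : oppset (diffset A) = diffset A.
Proof.
rewrite /diffset oppset_sumset sumsetC; congr sumset.
by apply/fsetP => x; rewrite !mem_oppset opprK.
Qed.

(** For each z in A - B fix one representation z = a - b. The map (z, x) -> (a + x, x + b) is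
    injective, because the difference of the two coordinates is z. *)
Lemma ruzsa_triangle A B X :
  (#|` sumset A (oppset B)| * #|` X| <= #|` sumset A X| * #|` sumset X B|)%N.
Proof.
rewrite -!card_fsetM.
have rep (z : V) : exists p : V * V, z \in sumset A (oppset B) ->
    [/\ p.1 \in A, p.2 \in B & z = p.1 - p.2].
  have [/sumsetP[a [b [aA]]]|_] := boolP (z \in _); last by exists (0, 0).
  by rewrite mem_oppset => bB ->; exists (a, - b); rewrite /= opprK.
have [f fP] := choice rep.
apply: (card_fset_inj (f := fun q => ((f q.1).1 + q.2, q.2 + (f q.1).2))).
  move=> [z x] [z' x']; rewrite !in_fsetM /= => /andP[zS xX] /andP[z'S x'X] [e1 e2].
  have [_ _ ez] := fP _ zS; have [_ _ ez'] := fP _ z'S.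
  have ezz : z = z'.
    rewrite ez ez'.
    have <- : ((f z).1 + x) - (x + (f z).2) = (f z).1 - (f z).2.
      by rewrite opprD addrA addrK.
    by rewrite e1 e2 opprD addrA addrK.
  by move: e1; rewrite ezz => /addrI ->.
move=> [z x]; rewrite !in_fsetM /= => /andP[zS xX].
by have [fA fB _] := fP _ zS; rewrite !mem_sumset.
Qed.

(** T grows greedily inside B as long as the translates of A by T stay disjoint. When A + b meets A
    + T, an equation a + b = a' + t puts b in T + (A - A). *)
Lemma ruzsa_covering A B : A != fset0 ->
  exists T, [/\ T `<=` B, (#|` T| * #|` A| <= #|` sumset A B|)%N
              & B `<=` sumset T (diffset A)].
Proof.
move=> A0.
suff [T [TB cT BT]] : exists T, [/\ T `<=` B, #|` sumset A T| = (#|` T| * #|` A|)%N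
              & B `<=` sumset T (diffset A)].
  by exists T; split => //; rewrite -cT card_sumsetS.
elim/fset1U_rect: B => [|b B _ [T [TB cT BT]]].
  by exists fset0; split; rewrite ?fsub0set // sumset_fset0 cardfs0.
have [dis|ndis] := boolP [disjoint sumset A [fset b] & sumset A T]%fset; last first.
  exists T; split => //; first exact: fsubset_trans TB (fsubsetUr _ _).
  rewrite fsubUset BT fsub1set andbT.
  move: ndis; rewrite -fsetI_eq0 => /fset0Pn[x /fsetIP[]].
  move=> /sumsetP[a [b' [aA /fset1P-> ->]]] /sumsetP[a' [t [a'A tT e]]].
  have -> : b = t + (a' - a) by rewrite addrA (addrC t) -e (addrC a) addrK.
  by rewrite mem_sumset // mem_sumset // mem_oppset opprK.
exists (b |` T); split; first exact: fsetUS.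
  rewrite sumsetUr cardfsU (disjoint_fsetI0 dis) cardfs0 subn0 cT.
  rewrite (sumsetC A) card_translate cardfsU1; case: (boolP (b \in T)) => [bT|_].
    have [a aA] := fset0Pn _ A0.
    move/fdisjointP: dis => /(_ (a + b)).
    by rewrite !mem_sumset // ?inE // => /(_ isT).
  by rewrite mulSn.
apply/fsubsetP => x /fset1UP[->|xB].
  by apply/sumsetP; exists b, 0; rewrite addr0 fset1U1 diffset_mem0.
have /sumsetP[t [y [tT yA ->]]] := fsubsetP BT x xB.
by rewrite mem_sumset // fset1Ur.
Qed.

(** X minimises |X + B| / |X| over the non-empty subsets of A, and C is built up one element at a
    time. *)
Lemma petridis A B : A != fset0 ->
  exists X, [/\ X `<=` A, X != fset0,
     (#|` sumset X B| * #|` A| <= #|` sumset A B| * #|` X|)%N &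
     forall C, (#|` sumset (sumset X B) C| * #|` X| <= #|` sumset X B| * #|` sumset X C|)%N].
Proof.
move=> A0.
pose ratio (X : {fset V}) : rat := #|` sumset X B|%:R / #|` X|%:R.
have Apow : A \in [fset X in fpowerset A | X != fset0].
  by rewrite !inE /= fpowersetE fsubset_refl.
have [X] := seq_argmin ratio Apow.
rewrite !inE /= fpowersetE => /andP[XA X0] Xmin.
have Xle Z : Z `<=` A ->
    (#|` sumset X B| * #|` Z| <= #|` sumset Z B| * #|` X|)%N.
  move=> ZA; have [->|Z0] := eqVneq Z fset0.
    by rewrite cardfs0 muln0.
  have := Xmin Z; rewrite !inE /= fpowersetE ZA Z0 => /(_ isT).
  rewrite /ratio ler_pdivrMr ?ltr0n ?cardfs_gt0 // mulrAC.
  by rewrite ler_pdivlMr ?ltr0n ?cardfs_gt0 // -!natrM ler_nat.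
exists X; split => //; first exact: Xle.
elim/fset1U_rect => [|c C _ IH]; first by rewrite !sumset_fset0 cardfs0 muln0.
(* Z collects the x for which x + B + c brings nothing new to X + B + C. Adding c to C creates at
   most |X + B| - |Z + B| points in X + B + C and at least |X| - |Z| points in X + C; minimality of
   X, applied to Z, compares the two. *)
pose Z := [fset x in X | sumset [fset x] (sumset B [fset c]) `<=` sumset (sumset X B) C].
have ZX : Z `<=` X by apply/fsubsetP => x; rewrite !inE => /andP[].
have le1 : (#|` sumset (sumset X B) (c |` C)| + #|` sumset Z B|
            <= #|` sumset (sumset X B) C| + #|` sumset X B|)%N.
  have ZS : sumset (sumset Z B) [fset c] `<=` sumset (sumset X B) [fset c].
    by rewrite sumsetS // sumsetS.
  have sub : sumset (sumset X B) (c |` C) `<=` sumset (sumset X B) C `|`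
      (sumset (sumset X B) [fset c] `\` sumset (sumset Z B) [fset c]).
    rewrite sumsetUr; apply/fsubsetP => y; rewrite !in_fsetU in_fsetD.
    case: (boolP (y \in sumset (sumset X B) C)) => //= yN; rewrite orbF => ->.
    rewrite andbT; apply/negP => /sumsetP[z [c' [/sumsetP[x [b [xZ bB ->]]] c'c ey]]].
    move: xZ; rewrite !inE => /andP[_ /fsubsetP /(_ y)]; rewrite (negPf yN) ey.
    by rewrite -addrA !mem_sumset ?fset11 // => /(_ isT).
  have := fsubset_leq_card sub; rewrite cardfsU (cardfsDS ZS).
  have := fsubset_leq_card ZS.
  rewrite !(sumsetC _ [fset c]) !card_translate; lia.
have le2 : (#|` sumset X C| + #|` X| <= #|` sumset X (c |` C)| + #|` Z|)%N.
  rewrite sumsetUr; have := cardfsUI (sumset X [fset c]) (sumset X C).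
  rewrite (sumsetC X [fset c]) card_translate => e.
  suff : (#|` sumset [fset c] X `&` sumset X C| <= #|` Z|)%N by lia.
  apply: (card_fset_inj (f := fun x => x - c)).
    by move=> x y _ _ /= /addIr.
  move=> y /fsetIP[/sumsetP[c' [x [/fset1P-> xX ->]]] cxC].
  rewrite addrAC subrr add0r !inE xX; apply/fsubsetP => z.
  move=> /sumsetP[x' [z' [/fset1P-> /sumsetP[b [c'' [bB /fset1P-> ->]]] ->]]].
  move: cxC => /sumsetP[x1 [c1 [x1X c1C e1]]].
  have -> : x + (b + c) = x1 + b + c1 by rewrite addrCA (addrC x) e1 addrCA addrA.
  by rewrite !mem_sumset.
have le3 := Xle _ (fsubset_trans ZX XA).
rewrite -(leq_add2r (#|` sumset X B| * #|` Z|)).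
apply: (@leq_trans ((#|` sumset (sumset X B) (c |` C)| + #|` sumset Z B|) * #|` X|)).
  by rewrite mulnDl leq_add2l.
rewrite -mulnDr; apply: (leq_trans (leq_mul le1 (leqnn _))).
rewrite mulnDl; apply: leq_trans (leq_mul (leqnn _) le2).
by rewrite mulnDr leq_add2r.
Qed.

End Sumsets.

(** * Progressions in sets of small doubling *)

Section Growth.
Variable V : zmodType.
Implicit Types (A B C X Y : {fset V}).

Lemma leq_expn2r m n e : (m <= n)%N -> (m ^ e <= n ^ e)%N.
Proof. by move=> mn; case: e => // e; rewrite leq_exp2r. Qed.

(** Taking C = pB in [petridis] gives |X + pB| <= K^p |X| by induction on p; the triangle inequality
    through X then joins nB and mB. *)
Lemma plunnecke A B K m n : A != fset0 ->
  (#|` sumset A B| <= K * #|` A|)%N ->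
  (#|` sumset (nfold n B) (oppset (nfold m B))| <= K ^ (n + m) * #|` A|)%N.
Proof.
move=> A0 leK; have [X [XA X0 leX petr]] := petridis B A0.
have Xgt0 : (0 < #|` X|)%N by rewrite cardfs_gt0.
have leXB : (#|` sumset X B| <= K * #|` X|)%N.
  rewrite -(@leq_pmul2r #|` A|) ?cardfs_gt0 //; apply: leq_trans leX _.
  by rewrite mulnAC leq_mul2r leK orbT.
have leXn p : (#|` sumset X (nfold p B)| <= K ^ p * #|` X|)%N.
  elim: p => [|p IH]; first by rewrite sumset0 expn0 mul1n.
  rewrite nfoldS sumsetA -(@leq_pmul2r #|` X|) //; apply: leq_trans (petr _) _.
  by apply: leq_trans (leq_mul leXB IH) _; rewrite expnS; nia.
rewrite -(@leq_pmul2r #|` X|) //; apply: leq_trans (ruzsa_triangle _ _ X) _.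
rewrite (sumsetC _ X); apply: leq_trans (leq_mul (leXn n) (leXn m)) _.
rewrite mulnACA -expnD mulnA leq_mul2r leq_mul2l.
by rewrite (fsubset_leq_card XA) !orbT.
Qed.

Lemma nfold_diffset n A : nfold n (diffset A) = sumset (nfold n A) (oppset (nfold n A)).
Proof. by rewrite /diffset nfold_sumset oppset_nfold. Qed.

Definition prog (t : V) M : {fset V} := [fset t *+ c | c in iota 0 M].

Lemma progP t M x : reflect (exists2 c, (c < M)%N & x = t *+ c) (x \in prog t M).
Proof.
by apply: (iffP (imfsetP _ _ _ _)) => -[c /= cM ->]; exists c => //;
  move: cM; rewrite mem_iota.
Qed.

Lemma card_prog t M : (#|` prog t M| <= M)%N.
Proof.
apply: leq_trans (leq_imfset_card _ _ _) _.
by rewrite /= undup_id ?iota_uniq // size_iota.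
Qed.

Lemma card_nfold n Y : (#|` nfold n Y| <= #|` Y| ^ n)%N.
Proof.
elim: n => [|n IH]; first by rewrite cardfs1.
by rewrite nfoldS expnS; apply: leq_trans (card_sumset _ _) _; rewrite leq_mul2l IH orbT.
Qed.

(** An element of nY is determined by its multiplicities, one number at most n for each element of
    Y. For fixed Y the growth in n is thus polynomial. *)
Lemma card_nfold_poly n Y : (#|` nfold n Y| <= n.+1 ^ #|` Y|)%N.
Proof.
pose box (s : seq V) := foldr (fun x B => sumset (prog x n.+1) B) [fset 0] s.
have cbox s : (#|` box s| <= n.+1 ^ size s)%N.
  elim: s => [|x s IH] /=; first by rewrite cardfs1.
  rewrite expnS; apply: leq_trans (card_sumset _ _) _.
  by rewrite leq_mul ?card_prog.
have mbox s (m : V -> nat) : (forall x, m x <= n)%N -> \sum_(x <- s) x *+ m x \in box s.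
  move=> mn; elim: s => [|x s IH] /=; first by rewrite big_nil fset11.
  by rewrite big_cons mem_sumset //; apply/progP; exists (m x); rewrite ?ltnS.
have dec p y : y \in nfold p Y ->
    exists2 m : V -> nat, (forall x, m x <= p)%N & y = \sum_(x <- Y) x *+ m x.
  elim: p y => [|p IH] y.
    by move=> /fset1P->; exists (fun=> 0%N) => //; rewrite big1.
  move=> /sumsetP[x [z [xY /IH[m mp ->] ->]]].
  exists (fun u => (u == x) + m u)%N.
    by move=> u; rewrite -[p.+1]add1n leq_add // leq_b1.
  under [RHS]eq_bigr do rewrite mulrnDr.
  rewrite big_split /=; congr (_ + _).
  rewrite (big_fsetD1 x) //= eqxx mulr1n big_seq big1 ?addr0 // => u.
  by rewrite !inE => /andP[/negPf-> _]; rewrite mulr0n.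
apply: leq_trans (cbox _); apply/fsubset_leq_card/fsubsetP => y /dec[m mn ->].
exact: mbox.
Qed.

Lemma prog_split t M N : prog t (M * N) `<=` sumset (prog t M) (prog (t *+ M) N).
Proof.
apply/fsubsetP => x /progP[c cMN ->].
have M0 : (0 < M)%N by case: M cMN.
rewrite {1}(divn_eq c M) addnC mulrnDr mem_sumset //.
  by apply/progP; exists (c %% M)%N; rewrite ?ltn_mod.
by apply/progP; exists (c %/ M)%N; rewrite ?ltn_divLR // ?mulrnA ?(mulnC N) // -!mulrnA mulnC.
Qed.

Section LongProgression.
Variables (A : {fset V}) (K : nat).
Let D := diffset A.
Hypothesis A0 : A != fset0.
Hypothesis growth : forall n, (#|` sumset (nfold n D) A| <= K ^ (2 * n + 1) * #|` A|)%N.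

Let D0 : 0 \in D. Proof. exact: diffset_mem0. Qed.

Lemma double_cover : exists X, (#|` X| <= K ^ 5)%N /\ nfold 2 D `<=` sumset X D.
Proof.
have [X [_ cX XD]] := ruzsa_covering (nfold 2 D) A0; exists X; split => //.
rewrite -(@leq_pmul2r #|` A|) ?cardfs_gt0 //; apply: leq_trans cX _.
by rewrite sumsetC; apply: growth.
Qed.

Lemma nfold_cover X n : nfold 2 D `<=` sumset X D -> nfold n.+1 D `<=` sumset (nfold n X) D.
Proof.
move=> DX; elim: n => [|n IH]; first by rewrite nfold1 sumset0l.
rewrite nfoldS; apply: fsubset_trans (sumsetS (fsubset_refl _) IH) _.
rewrite sumsetA (sumsetC D) -sumsetA nfoldS (sumsetC X) -sumsetA.
apply: sumsetS => //; apply: fsubset_trans DX.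
by rewrite nfoldS nfold1.
Qed.

(** Since (2q + 1)D lies in 2qX + D, the number of translates is polynomial in q, while a
    progression with q binary digits has 2^q terms. The factor K^3 is the growth bound for D + A. *)
Lemma block_cover q : exists Y, (#|` Y| <= (2 * q).+1 ^ (K ^ 5) * K ^ 3)%N /\
  nfold (2 * q).+1 D `<=` sumset Y D.
Proof.
have [X [cX DX]] := double_cover.
have [Y [_ cY YD]] := ruzsa_covering (nfold (2 * q).+1 D) A0; exists Y; split => //.
rewrite -(@leq_pmul2r #|` A|) ?cardfs_gt0 //; apply: leq_trans cY _.
apply: leq_trans (card_sumsetS _ (nfold_cover _ DX)) _.
rewrite sumsetC -sumsetA; apply: leq_trans (card_sumset _ _) _.
rewrite -mulnA leq_mul //; last first.
  by have := growth 1; rewrite nfold1 sumsetC.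
apply: leq_trans (card_nfold_poly _ _) _.
by rewrite leq_pexp2l.
Qed.

(* Repeatedly writing 2b = x + b' with x in X and b' in D attaches to each b a
   word in X; two elements with the same word differ by the required t. *)
Lemma doubling_orbit X J : nfold 2 D `<=` sumset X D -> (#|` X| ^ J < #|` A|)%N ->
  exists t, t != 0 /\ forall j, (j <= J)%N -> t *+ (2 ^ j) \in nfold 2 D.
Proof.
move=> DX ltJ.
have step (b : D) : exists p : X * D, val b + val b = val p.1 + val p.2.
  have /sumsetP[x [y [xX yD e]]] : val b + val b \in sumset X D.
    by apply: (fsubsetP DX); rewrite nfoldS nfold1; apply: mem_sumset; apply: fsvalP.
  by exists ([` xX], [` yD]).
have [f fP] := fin_all_exists step.
pose nx b := (f b).2; pose word b : J.-tuple X := [tuple (f (iter j nx b)).1 | j < J].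
have orb (b b' : D) : word b = word b' -> forall j, (j <= J)%N ->
    (val b - val b') *+ (2 ^ j) = val (iter j nx b) - val (iter j nx b').
  move=> ew; elim=> [|j IH] jJ; first by rewrite expn0 mulr1n.
  rewrite expnS mulnC mulrnA IH ?(ltnW jJ) // mulrnBl !mulr2n !fP /=.
  have := congr1 (fun w => tnth w (Ordinal jJ)) ew; rewrite !tnth_mktuple /= => ->.
  by rewrite opprD addrACA subrr add0r.
have [/injectiveP inj|/injectivePn[b [b' neq ew]]] := boolP (injectiveb word).
  have := leq_card _ inj; rewrite card_tuple -!cardfE => le.
  have : (#|` A| <= #|` D|)%N.
    have [a aA] := fset0Pn _ A0; apply: (@card_sumset_ge _ A (oppset A) (- a)).
    by rewrite mem_oppset opprK.
  by move=> /leq_trans/(_ le); rewrite leqNgt ltJ.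
exists (val b - val b'); split; first by rewrite subr_eq0 (inj_eq val_inj).
move=> j jJ; rewrite orb // nfoldS nfold1; apply: mem_sumset; first exact: fsvalP.
have DN x : x \in D -> - x \in D.
  by move=> xD; rewrite /D -oppset_diffset mem_oppset opprK.
exact/DN/fsvalP.
Qed.

Lemma prog_nfold s q : (forall e, (e < q)%N -> s *+ (2 ^ e) \in nfold 2 D) ->
  prog s (2 ^ q) `<=` nfold (2 * q) D.
Proof.
elim: q => [|q IH] sD.
  by apply/fsubsetP => x /progP[[|c]] // _ ->; rewrite mulr0n nfold_mem0.
rewrite expnSr; apply: fsubset_trans (prog_split _ _ _) _.
rewrite mulnSr nfoldD; apply: sumsetS; first by apply: IH => e eq; apply/sD/ltnW.
apply/fsubsetP => x /progP[[|[|c]]] // _ ->; first by rewrite mulr0n nfold_mem0.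
by rewrite mulr1n sD.
Qed.

(** The q * n binary digits are cut into n blocks of q. Adding one block to D stays within (2q +
    1)D, hence within Y + D, so each block costs one summand Y. *)
Lemma prog_cover t Y q n : nfold (2 * q).+1 D `<=` sumset Y D ->
  (forall j, (j < q * n)%N -> t *+ (2 ^ j) \in nfold 2 D) ->
  sumset D (prog t (2 ^ (q * n))) `<=` sumset (nfold n Y) D.
Proof.
move=> DY; elim: n => [|n IH] tD.
  rewrite muln0 expn0 sumset0l; apply/fsubsetP => x /sumsetP[a [b [aD /progP[[|c]]]]] //.
  by move=> _ -> ->; rewrite mulr0n addr0.
rewrite mulnS addnC expnD.
apply: fsubset_trans (sumsetS (fsubset_refl _) (prog_split _ _ _)) _.
rewrite sumsetA nfoldS (sumsetC Y) -(sumsetA _ Y).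
have le1 : sumset D (prog t (2 ^ (q * n))) `<=` sumset (nfold n Y) D.
  by apply: IH => j jn; apply: tD; rewrite mulnS; lia.
apply: fsubset_trans (sumsetS le1 (fsubset_refl _)) _.
rewrite -sumsetA; apply: sumsetS => //; apply: fsubset_trans DY.
rewrite nfoldS; apply: sumsetS => //; apply: prog_nfold => e eq.
by rewrite -mulrnA -expnD tD // mulnS; lia.
Qed.

End LongProgression.

Lemma poly_le_expn a b : exists q, (0 < q)%N /\ ((2 * q).+1 ^ a * b <= 2 ^ q)%N.
Proof.
pose u := (2 * a + b)%N.
have ltu : (u < 2 ^ u)%N by apply: ltn_expl.
exists (2 ^ (2 * u))%N; rewrite expn_gt0; split => //.
apply: (@leq_trans (2 ^ ((2 * u + 2) * a) * 2 ^ b)).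
  apply: leq_mul; last exact/ltnW/ltn_expl.
  rewrite (expnM 2 (2 * u + 2)); apply: leq_expn2r; rewrite expnD.
  by have : (0 < 2 ^ (2 * u))%N; [rewrite expn_gt0 | lia].
rewrite -expnD; apply: leq_pexp2l => //; rewrite mul2n -addnn expnD.
apply: leq_trans (leq_mul ltu ltu); rewrite /u; nia.
Qed.

(** With q such that one block of q digits needs at most 2^(q/2) translates, a progression of 2^(qn)
    terms is absorbed by 2^(qn/2) translates of D. This square-root saving is available as long as
    r^(qn) < |A|. *)
Lemma long_progression K : exists q r, (0 < q)%N /\ (1 < r)%N /\
  forall A, A != fset0 ->
  (forall n, (#|` sumset (nfold n (diffset A)) A| <= K ^ (2 * n + 1) * #|` A|)%N) ->
  forall n, (r ^ (q * n) < #|` A|)%N ->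
  exists t Z, [/\ t != 0, (#|` Z| ^ 2 <= 2 ^ (q * n))%N &
    sumset (diffset A) (prog t (2 ^ (q * n))) `<=` sumset Z (diffset A)].
Proof.
have [q [q0 qP]] := poly_le_expn (2 * K ^ 5) ((K ^ 3) ^ 2).
exists q, (K ^ 5).+2; split => //; split => // A A0 gr n ltn.
have [X [cX DX]] := double_cover A0 gr.
have [Y [cY DY]] := block_cover A0 gr q.
have [|t [t0 tD]] := @doubling_orbit A A0 X (q * n) DX.
  by apply: leq_ltn_trans ltn; apply: leq_expn2r; lia.
exists t, (nfold n Y); split => //.
  have leY : (#|` Y| ^ 2 <= 2 ^ q)%N.
    by apply: leq_trans qP; rewrite (mulnC 2 (K ^ 5)%N) (expnM _ (K ^ 5)%N) -expnMn leq_exp2r.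
  rewrite expnM; apply: (@leq_trans ((#|` Y| ^ n) ^ 2)).
    by rewrite leq_exp2r // card_nfold.
  by rewrite -expnM mulnC expnM; apply: leq_expn2r.
by apply: prog_cover => // j /ltnW; apply: tD.
Qed.

End Growth.

(** * Images under additive maps *)

Section GrowthImage.
Variables (V W : zmodType) (f : {additive V -> W}).
Implicit Types A B : {fset V}.

Lemma imfset_sumset A B : f @` sumset A B = sumset (f @` A) (f @` B).
Proof.
apply/fsetP => y; apply/imfsetP/sumsetP.
  move=> [x /= /sumsetP[a [b [aA bB ->]]] ->]; exists (f a), (f b).
  by rewrite raddfD !in_imfset.
move=> [_ [_ [/imfsetP[a /= aA ->] /imfsetP[b /= bB ->] ->]]].
by exists (a + b); rewrite ?raddfD //= mem_sumset.
Qed.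

Lemma imfset_oppset A : f @` oppset A = oppset (f @` A).
Proof. by rewrite /oppset -!imfset_comp; apply: eq_imfset => // x /=; rewrite raddfN. Qed.

Lemma imfset_diffset A : f @` diffset A = diffset (f @` A).
Proof. by rewrite /diffset imfset_sumset imfset_oppset. Qed.

Lemma imfset_nfold n A : f @` nfold n A = nfold n (f @` A).
Proof.
elim: n => [|n IH]; first by rewrite /nfold /= imfset_fset1 raddf0.
by rewrite !nfoldS imfset_sumset IH.
Qed.

Lemma imfset_prog t M : f @` prog t M = prog (f t) M.
Proof. by rewrite /prog -imfset_comp; apply: eq_imfset => // x /=; rewrite raddfMn. Qed.

End GrowthImage.

(** The image of nD + A under f is (n + 1)f(A) - n f(A), to which the Plunnecke inequality for the
    pair A, f(A) applies. *)
Lemma dilate_growth (V : zmodType) (f : {additive V -> V}) A K n :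
  injective f -> A != fset0 -> (#|` sumset A (f @` A)| <= K * #|` A|)%N ->
  (#|` sumset (nfold n (diffset A)) A| <= K ^ (2 * n + 1) * #|` A|)%N.
Proof.
move=> f_inj A0 leK; have := plunnecke n n.+1 A0 leK.
rewrite -(card_inj_imfset (sumset (nfold n (diffset A)) A) f_inj) imfset_sumset imfset_nfold imfset_diffset.
rewrite nfold_diffset sumsetAC (sumsetC (nfold n _)) -nfoldS.
by rewrite (_ : n.+1 + n = 2 * n + 1)%N //; lia.
Qed.

Lemma card_fset_partition (T T' : choiceType) (f : T -> T') (A : {fset T}) (R : {fset T'}) :
  (forall x, x \in A -> f x \in R) ->
  #|` A| = (\sum_(r <- R) #|` [fset x in A | f x == r]|)%N.
Proof.
move=> fR.
under eq_bigr do rewrite card_fset_sum1 big_fset /=.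
rewrite (exchange_big_dep xpredT) //= card_fset_sum1 big_seq [RHS]big_seq.
apply: eq_bigr => x xA.
rewrite big_mkcond (big_fsetD1 (f x)) ?fR //= eqxx big_seq big1 ?addn0 // => r.
by rewrite !inE eq_sym => /andP[/negPf->].
Qed.

Lemma sum_ltn_minn n T : (\sum_(t < T) (t < n)%N = minn T n)%N.
Proof. by elim: T => [|T IH]; rewrite ?big_ord0 ?big_ord_recr /= ?IH; lia. Qed.

(** * A discrete Brunn-Minkowski inequality *)

Section RealInequalities.
Variable R : realType.
Implicit Types x y l : R.

Lemma power_mean x y l n : 0 <= x -> 0 <= y -> 0 <= l -> l <= 1 ->
  (l * x + (1 - l) * y) ^+ n.+1 <= l * x ^+ n.+1 + (1 - l) * y ^+ n.+1.
Proof.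
move=> x0 y0 l0 l1; have l'0 : 0 <= 1 - l by rewrite subr_ge0.
elim: n => [|n IH]; first by rewrite !expr1.
rewrite exprS; set mu := l * x + _ in IH *.
have mu0 : 0 <= mu by rewrite addr_ge0 // mulr_ge0.
apply: le_trans (ler_wpM2l mu0 IH) _; rewrite -subr_ge0.
have -> : l * x ^+ n.+2 + (1 - l) * y ^+ n.+2 -
    mu * (l * x ^+ n.+1 + (1 - l) * y ^+ n.+1) =
    l * (1 - l) * ((x - y) * (x ^+ n.+1 - y ^+ n.+1)).
  by rewrite /mu !(exprS _ n.+1); ring.
apply: mulr_ge0; first exact: mulr_ge0.
have [xy|/ltW yx] := leP x y.
  by rewrite -mulrNN !opprB; apply: mulr_ge0; rewrite subr_ge0 // lerXn2r.
by apply: mulr_ge0; rewrite subr_ge0 // lerXn2r.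
Qed.

(** Convexity of the power function at the points x / l and y / (1 - l). *)
Lemma radon x y l m : 0 <= x -> 0 <= y -> 0 < l -> l < 1 ->
  (x + y) ^+ m.+1 <= x ^+ m.+1 / l ^+ m + y ^+ m.+1 / (1 - l) ^+ m.
Proof.
move=> x0 y0 l0 l1; have l'0 : 0 < 1 - l by rewrite subr_gt0.
have := power_mean m (divr_ge0 x0 (ltW l0)) (divr_ge0 y0 (ltW l'0)) (ltW l0) (ltW l1).
rewrite mulrCA divff ?gt_eqF // mulr1 mulrCA divff ?gt_eqF // mulr1.
suff e (z w : R) : w != 0 -> w * (z / w) ^+ m.+1 = z ^+ m.+1 / w ^+ m.
  by rewrite !e // gt_eqF.
by move=> w0; rewrite expr_div_n (exprS w) invfM; field; rewrite w0 expf_neq0.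
Qed.

(* The sequence F 0, F 0, F 1, F 2, ... dominates the decreasing merge of u and v
   term by term. *)
Lemma merge_sum (u v F : nat -> R) p q :
  (forall a b, (a <= b)%N -> u b <= u a) -> (forall a b, (a <= b)%N -> v b <= v a) ->
  u 0%N = v 0%N ->
  (forall a b, (a <= p)%N -> (b <= q)%N -> Num.min (u a) (v b) <= F (a + b)%N) ->
  \sum_(a < p.+1) u a + \sum_(b < q.+1) v b <= F 0%N + \sum_(t < (p + q).+1) F t.
Proof.
move=> u_dec v_dec uv0.
have [n] := ubnP (p + q); elim: n p q => // n IH p q ltn HF.
have Hpq := HF p q (leqnn _) (leqnn _).
pose goal p q := \sum_(a < p.+1) u a + \sum_(b < q.+1) v b
  <= F 0%N + \sum_(t < (p + q).+1) F t.
(* The smaller of the last terms [u p] and [v q] is at most [F (p + q)]; removing it together with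
   this value of F lowers p + q by one. *)
have dropu p' : p = p'.+1 -> u p <= v q -> goal p q.
  move=> ep uv; move: Hpq; rewrite (min_idPl uv) ep => Hpq.
  have IH' : goal p' q.
    by apply: IH => [|a b ap bq]; [move: ltn; rewrite ep; lia | apply: HF; rewrite ?ep; lia].
  rewrite /goal big_ord_recr /= addSn (big_ord_recr (p' + q).+1) /=.
  by move: IH' Hpq; rewrite /goal addSn; lra.
have dropv q' : q = q'.+1 -> v q <= u p -> goal p q.
  move=> eq uv; move: Hpq; rewrite (min_idPr uv) eq => Hpq.
  have IH' : goal p q'.
    by apply: IH => [|a b ap bq]; [move: ltn; rewrite eq; lia | apply: HF; rewrite ?eq; lia].
  rewrite /goal (big_ord_recr q'.+1) /= addnS (big_ord_recr (p + q').+1) /=.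
  by move: IH' Hpq; rewrite /goal addnS; lra.
have base : p = 0%N -> q = 0%N -> goal p q.
  move=> ep eq; move: Hpq; rewrite /goal ep eq !big_ord1 -uv0 minxx => ?.
  exact: lerD.
rewrite -/(goal p q); have [uv|/ltW vu] := leP (u p) (v q).
  case ep: p => [|p']; last by rewrite -ep; apply: dropu ep uv.
  case eq: q => [|q']; first by have := base ep eq; rewrite ep eq.
  by rewrite -ep -eq; apply: dropv eq _; rewrite ep uv0 v_dec.
case eq: q => [|q']; last by rewrite -eq; apply: dropv eq vu.
case ep: p => [|p']; first by have := base ep eq; rewrite ep eq.
by rewrite -ep -eq; apply: dropu ep _; rewrite eq -uv0 u_dec.
Qed.
End RealInequalities.

(** * Layers and compressions *)

Section Layers.
Variable d : nat.
Local Notation V := 'cV[int]_d.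
Implicit Types (S X Y : {fset V}) (i j : 'I_d).

Definition proj j : V -> V := mulmx (1%:M - delta_mx j j).

Lemma projE j (v : V) i : proj j v i 0 = if i == j then 0 else v i 0.
Proof.
rewrite /proj mulmxBl mul1mx !mxE (bigD1 j) //= big1 => [|l lj]; rewrite !mxE ?(eqxx, andbT) /=.
  by have [->|] := eqVneq i j; rewrite ?mul1r ?mul0r addr0 ?subrr ?subr0.
by rewrite (negPf lj) andbF mul0r.
Qed.

Lemma proj_inj j (v w : V) : proj j v = proj j w -> v j 0 = w j 0 -> v = w.
Proof.
move=> e ej; apply/matrixP => i l; rewrite !ord1.
have [->//|ij] := eqVneq i j.
by have := congr1 (fun u : V => u i 0) e; rewrite !projE (negPf ij).
Qed.

Lemma projC i j (v : V) : proj i (proj j v) = proj j (proj i v).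
Proof.
by apply/matrixP => l m; rewrite !ord1 !projE; case: (l == i); case: (l == j).
Qed.

(** [fib] is a line of S in direction j. The layers are the horizontal slices of the compression of
    S along j: layer t has one point for every line carrying more than t points of S. *)
Definition fib j S w : {fset V} := [fset x in S | proj j x == w].
Definition layer j S t : {fset V} := [fset w in proj j @` S | (t < #|` fib j S w|)%N].

Lemma in_fib j S w x : (x \in fib j S w) = (x \in S) && (proj j x == w).
Proof. by rewrite !inE. Qed.

Lemma in_layer j S t w : (w \in layer j S t) = (t < #|` fib j S w|)%N.
Proof.
rewrite !inE /=; case: (ltnP t _) => [lt|]; rewrite ?andbF ?andbT //.
have : (0 < #|` fib j S w|)%N by apply: leq_ltn_trans lt.
rewrite cardfs_gt0 => /fset0Pn[x]; rewrite in_fib => /andP[xS /eqP<-].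
exact: in_imfset.
Qed.

Lemma fibS j S S' w : S `<=` S' -> fib j S w `<=` fib j S' w.
Proof.
move=> /fsubsetP SS'; apply/fsubsetP => x; rewrite !in_fib => /andP[/SS'-> ->] //.
Qed.

Lemma layerS j S S' t : S `<=` S' -> layer j S t `<=` layer j S' t.
Proof.
move=> SS'; apply/fsubsetP => x; rewrite !in_layer => /leq_trans; apply.
exact/fsubset_leq_card/fibS.
Qed.

Lemma layer_decr j S s t : (s <= t)%N -> layer j S t `<=` layer j S s.
Proof. by move=> st; apply/fsubsetP => x; rewrite !in_layer; apply: leq_ltn_trans. Qed.

Lemma layer_sub j S t : layer j S t `<=` proj j @` S.
Proof. exact: fset_sub. Qed.

Lemma sum_layer j S T : (\sum_(t < T) #|` layer j S t| =
  \sum_(w <- proj j @` S) minn T #|` fib j S w|)%N.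
Proof.
transitivity (\sum_(t < T) \sum_(w <- proj j @` S) (t < #|` fib j S w|)%N)%N.
  by apply: eq_bigr => t _; rewrite card_fset_sum1 big_fset /= big_mkcond.
rewrite exchange_big /=; apply: eq_bigr => w _; rewrite -sum_ltn_minn.
by apply: eq_bigr => t _; case: ltnP.
Qed.

Lemma card_fibs j S : #|` S| = (\sum_(w <- proj j @` S) #|` fib j S w|)%N.
Proof. by apply: card_fset_partition => x xS; apply: in_imfset. Qed.

Lemma sum_layer_le j S T : (\sum_(t < T) #|` layer j S t| <= #|` S|)%N.
Proof. by rewrite sum_layer (card_fibs j S) leq_sum // => w _; apply: geq_minr. Qed.

Lemma sum_layer_eq j S T : layer j S T = fset0 -> (\sum_(t < T) #|` layer j S t| = #|` S|)%N.
Proof.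
move=> l0; rewrite sum_layer (card_fibs j S); apply: eq_bigr => w _.
by apply/minn_idPr; rewrite leqNgt -in_layer l0.
Qed.

Lemma layer_lt_card j S t w : w \in layer j S t -> (t < #|` S|)%N.
Proof. by rewrite in_layer => /leq_trans; apply; apply/fsubset_leq_card/fset_sub. Qed.

(** Points of one line in direction j differ only in coordinate j, which [proj i] keeps; so [proj i]
    does not shrink any fibre. *)
Lemma layer_proj i j S t : i != j -> proj i @` layer j S t `<=` layer j (proj i @` S) t.
Proof.
move=> ij; apply/fsubsetP => _ /imfsetP[w /= wl ->].
move: wl; rewrite !in_layer => /leq_trans; apply.
apply: (card_fset_inj (f := proj i)).
  move=> x y; rewrite !in_fib => /andP[_ /eqP<-] /andP[_ /eqP exy] e.
  apply: (@proj_inj j) => //.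
  by have := congr1 (fun u : V => u j 0) e; rewrite !projE eq_sym (negPf ij).
move=> x; rewrite !in_fib => /andP[xS /eqP<-].
by rewrite projC eqxx andbT in_imfset.
Qed.

(** With p the highest point of X and q the lowest point of Y in coordinate j, the translates q + X
    and p + Y lie in X + Y and share at most p + q. *)
Lemma card_sumset_line j X Y : X != fset0 -> Y != fset0 ->
  {in X &, forall x y : V, x j 0 = y j 0 -> x = y} ->
  (#|` X| + #|` Y| <= #|` sumset X Y| + 1)%N.
Proof.
move=> /fset0Pn[x0 x0X] /fset0Pn[y0 y0Y] Xinj.
have [p pX pmax] := seq_argmin (fun x : V => - x j 0) x0X.
have [q qY qmin] := seq_argmin (fun x : V => x j 0) y0Y.
rewrite -(card_translate q X) -(card_translate p Y) -cardfsUI leq_add //.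
  apply/fsubset_leq_card; rewrite fsubUset (sumsetC [fset q]).
  by rewrite !sumsetS ?fsub1set.
apply: (@leq_trans #|` [fset p + q]|); last by rewrite cardfs1.
apply/fsubset_leq_card/fsubsetP => z.
rewrite in_fsetI => /andP[/sumsetP[q' [x [/fset1P-> xX ->]]]].
move=> /sumsetP[p' [y [/fset1P-> yY e]]].
have /eqP := congr1 (fun u : V => u j 0) e; rewrite !mxE => /eqP ej.
have := pmax x xX; have := qmin y yY; rewrite lerN2 => h1 h2.
have exp : x = p.
  apply: Xinj => //; apply/eqP; rewrite eq_le h2 /=.
  have := lerD (lexx (p j 0)) h1; by rewrite -ej (addrC (p j 0)) lerD2l.
by rewrite inE exp addrC.
Qed.

(** Lines with at least a + 1 and b + 1 points add up to a line with at least a + b + 1 points. *)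
Lemma layer_sumset j X Y a b :
  sumset (layer j X a) (layer j Y b) `<=` layer j (sumset X Y) (a + b).
Proof.
apply/fsubsetP => _ /sumsetP[w [w' [wX w'Y ->]]]; move: wX w'Y; rewrite !in_layer => wX w'Y.
have := @card_sumset_line j (fib j X w) (fib j Y w').
rewrite -!cardfs_gt0 (leq_ltn_trans _ wX) // (leq_ltn_trans _ w'Y) // => /(_ isT isT).
have sub : sumset (fib j X w) (fib j Y w') `<=` fib j (sumset X Y) (w + w').
  apply/fsubsetP => _ /sumsetP[x [y [xw yw ->]]].
  move: xw yw; rewrite !in_fib => /andP[xX /eqP<-] /andP[yY /eqP<-].
  by rewrite mem_sumset //= /proj mulmxDr.
have := fsubset_leq_card sub => le1 le2.
suff : (#|` fib j X w| + #|` fib j Y w'| <= #|` sumset (fib j X w) (fib j Y w')| + 1)%N.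
  move=> h; apply: leq_trans le1; rewrite -(leq_add2r 1); apply: leq_trans h.
  by rewrite addn1 -addSn -addnS leq_add.
apply: le2 => x y; rewrite !in_fib => /andP[_ /eqP<-] /andP[_ /eqP e1] e2.
by apply: (@proj_inj j).
Qed.

(* The number of points of S + {0,1}^js once S is compressed along the directions js. *)
Fixpoint boxsize (js : seq 'I_d) S : nat :=
  if js is j :: js' then
    (\sum_(t < #|` S|) boxsize js' (layer j S t) + boxsize js' (layer j S 0))%N
  else #|` S|.

Lemma boxsizeS js S S' : S `<=` S' -> (boxsize js S <= boxsize js S')%N.
Proof.
elim: js S S' => [|j js IH] S S' SS' /=; first exact: fsubset_leq_card.
rewrite leq_add ?IH ?layerS //.
have le := fsubset_leq_card SS'; rewrite -(subnKC le) big_split_ord /=.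
by apply: leq_trans (leq_addr _ _); apply: leq_sum => t _; rewrite IH // layerS.
Qed.

(** The box adds one copy of the bottom layer in direction j, and this layer is contained in the
    projection along j. For another direction i, the projected layers lie in the layers of the
    projection along i, whose sizes add up to at most its cardinality. *)
Lemma boxsize_le js : uniq js -> exists C, forall S,
  (boxsize js S <= #|` S| + C * \sum_(j <- js) #|` proj j @` S|)%N.
Proof.
elim: js => [|j js IH] /=; first by exists 0%N => S; rewrite addn0.
move=> /andP[jjs /IH[C HC]]; exists (1 + C * size js + C)%N => S.
have e0 : (\sum_(i <- js) #|` proj i @` layer j S 0| <= size js * #|` proj j @` S|)%N.
  rewrite -sum1_size big_distrl /=; apply: leq_sum => i _; rewrite mul1n.
  by apply: leq_trans (leq_imfset_card _ _ _) _; apply/fsubset_leq_card/layer_sub.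
have e1 : (\sum_(t < #|` S|) \sum_(i <- js) #|` proj i @` layer j S t|
    <= \sum_(i <- js) #|` proj i @` S|)%N.
  rewrite exchange_big /= big_seq [X in (_ <= X)%N]big_seq; apply: leq_sum => i ijs.
  apply: leq_trans (sum_layer_le j (proj i @` S) #|` S|); apply: leq_sum => t _.
  by apply/fsubset_leq_card/layer_proj; apply: contraNneq jjs => <-.
have e2 : (\sum_(t < #|` S|) boxsize js (layer j S t) <=
    #|` S| + C * \sum_(i <- js) #|` proj i @` S|)%N.
  apply: (@leq_trans (\sum_(t < #|` S|)
    (#|` layer j S t| + C * \sum_(i <- js) #|` proj i @` layer j S t|))%N).
    by apply: leq_sum.
  by rewrite big_split /= -big_distrr /= leq_add ?sum_layer_le // leq_mul2l e1 orbT.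
have e3 : (#|` layer j S 0| <= #|` proj j @` S|)%N by apply/fsubset_leq_card/layer_sub.
rewrite big_cons.
apply: leq_trans (leq_add e2 (leq_trans (HC _) (leq_add e3 (leq_mul (leqnn C) e0)))) _.
move: #|` S| #|` _ @` _| (size js) (\sum_(i <- js) _)%N => s p m x.
by rewrite -addnA leq_add2l mulnDr !mulnDl -!mulnA; lia.
Qed.

End Layers.

Lemma root_exists (R : realType) (m : nat) (z : R) : 0 <= z -> (0 < m)%N ->
  exists2 w : R, 0 <= w & w ^+ m = z.
Proof.
move=> z0 m0; exists (z `^ (m%:R^-1)); first exact: powR_ge0.
by rewrite -powR_mulrn ?powR_ge0 // -powRrM mulVf ?powRr1 // pnatr_eq0 -lt0n.
Qed.

Section BrunnMinkowski.
Variables (R : realType) (d : nat).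
Local Notation V := 'cV[int]_d.
Implicit Types (S X Y : {fset V}) (i j : 'I_d).

Let supported (js : seq 'I_d) X := forall v : V, v \in X -> forall i, i \notin js -> v i 0 = 0.

Lemma supported_layer j js X t : supported (j :: js) X -> supported js (layer j X t).
Proof.
move=> sX w /(fsubsetP (layer_sub j X t)) /imfsetP[x /= xX ->] i ijs.
rewrite projE; have [//|ij] := eqVneq i j.
by apply: sX => //; rewrite inE negb_or ij.
Qed.

Lemma layer_top j X : X != fset0 -> exists p, layer j X p.+1 = fset0 /\
  forall a, (a <= p)%N -> layer j X a != fset0.
Proof.
move=> /fset0Pn[x xX].
have ex : exists a, layer j X a != fset0.
  exists 0%N; apply/fset0Pn; exists (proj j x); rewrite in_layer cardfs_gt0.
  by apply/fset0Pn; exists x; rewrite in_fib xX eqxx.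
have bd a : layer j X a != fset0 -> (a <= #|` X|)%N.
  by move=> /fset0Pn[w /layer_lt_card/ltnW].
case: (ex_maxnP ex bd) => p p0 pmax; exists p; split.
  by apply/eqP; apply: contraT => /pmax; rewrite ltnn.
move=> a ap; apply: fsubset_neq0 p0; exact: layer_decr.
Qed.

(** Induction on the directions. Layers a of X and b of Y add into layer a + b of X + Y, so the case
    of one direction less bounds [F (a + b)] below by a minimum of rescaled layer sizes. [merge_sum]
    adds these bounds, its doubled term [F 0] being the extra summand of [boxsize], and [radon]
    recombines |X| and |Y|. *)
Lemma boxsize_BM js X Y (x y : R) : X != fset0 -> Y != fset0 ->
  supported js X -> supported js Y -> 0 <= x -> 0 <= y ->
  x ^+ size js <= #|` X|%:R -> y ^+ size js <= #|` Y|%:R ->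
  (x + y) ^+ size js <= (boxsize js (sumset X Y))%:R.
Proof.
elim: js X Y x y => [|j js IH] X Y x y X0 Y0 sX sY x0 y0 xX yY.
  rewrite expr0 /= ler1n cardfs_gt0; have [a aX] := fset0Pn _ X0.
  by have [b bY] := fset0Pn _ Y0; apply/fset0Pn; exists (a + b); rewrite mem_sumset.
have [p [pE pN]] := layer_top j X0; have [q [qE qN]] := layer_top j Y0.
have cX := sum_layer_eq pE; have cY := sum_layer_eq qE.
pose S := sumset X Y; pose F t : R := (boxsize js (layer j S t))%:R.
have Sne : layer j S (p + q) != fset0.
  have [w wX] := fset0Pn _ (pN p (leqnn _)); have [w' wY] := fset0Pn _ (qN q (leqnn _)).
  apply/fset0Pn; exists (w + w'); apply: (fsubsetP (layer_sumset j X Y p q)).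
  exact: mem_sumset.
have ltpq : (p + q < #|` S|)%N by have [w /layer_lt_card] := fset0Pn _ Sne.
have sumF : F 0%N + \sum_(t < (p + q).+1) F t <= (boxsize (j :: js) S)%:R.
  rewrite /= natrD addrC lerD2r natr_sum -(subnKC ltpq) big_split_ord /= lerDl.
  by apply: sumr_ge0 => t _; apply: ler0n.
apply: le_trans sumF.
have layF a b : layer j X a != fset0 -> layer j Y b != fset0 -> forall x' y' : R,
    0 <= x' -> 0 <= y' -> x' ^+ size js <= #|` layer j X a|%:R ->
    y' ^+ size js <= #|` layer j Y b|%:R -> (x' + y') ^+ size js <= F (a + b)%N.
  move=> a0 b0 x' y' x'0 y'0 hx hy.
  apply: le_trans (IH _ _ _ _ a0 b0 (supported_layer sX) (supported_layer sY) x'0 y'0 hx hy) _.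
  by rewrite ler_nat; apply/boxsizeS/layer_sumset.
have gt0 Z t : layer j Z t != fset0 -> (0 : R) < #|` layer j Z t|%:R.
  by rewrite ltr0n cardfs_gt0.
have X00 := pN 0%N (leq0n _); have Y00 := qN 0%N (leq0n _).
pose m := size js.
(* l is chosen so that the two rescaled layer profiles have the same maximum *)
have [l [l0 l1 top minF]] : exists l : R, [/\ 0 < l, l < 1,
    #|` layer j X 0|%:R / l ^+ m = #|` layer j Y 0|%:R / (1 - l) ^+ m &
    forall a b, layer j X a != fset0 -> layer j Y b != fset0 ->
      Num.min (#|` layer j X a|%:R / l ^+ m) (#|` layer j Y b|%:R / (1 - l) ^+ m)
        <= F (a + b)%N].
  have [m0|m_gt0] := posnP m.
    have one Z t : supported (j :: js) Z -> layer j Z t != fset0 ->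
        #|` layer j Z t| = 1%N.
      move=> sZ Z0; apply/eqP; rewrite eqn_leq cardfs_gt0 Z0 andbT.
      apply: (@leq_trans #|` [fset (0 : V)]|); last by rewrite cardfs1.
      apply/fsubset_leq_card/fsubsetP => w wZ; apply/fset1P/matrixP => i k.
      by rewrite !ord1 mxE (supported_layer sZ wZ) // (size0nil m0).
    exists (2%:R^-1); rewrite m0 !expr0 !divr1 !one //; split; [lra|lra|by []|].
    move=> a b a0 b0; have := layF a b a0 b0 0 0 (lexx _) (lexx _).
    by rewrite -/m m0 !expr0 !one // !divr1 minxx; apply.
  have [u u0 uE] := root_exists (ltW (gt0 X _ X00)) m_gt0.
  have [v v0 vE] := root_exists (ltW (gt0 Y _ Y00)) m_gt0.
  have pos (z : R) n : 0 <= z -> z ^+ m = n -> 0 < n -> 0 < z.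
    move=> z0 e n0; rewrite lt0r z0 andbT; apply: contraTneq n0 => z00.
    by rewrite -e z00 expr0n gtn_eqF // ltxx.
  have {}u0 := pos _ _ u0 uE (gt0 X _ X00); have {}v0 := pos _ _ v0 vE (gt0 Y _ Y00).
  have uv0 : 0 < u + v by apply: addr_gt0.
  have e1 : 1 - u / (u + v) = v / (u + v) by field; rewrite gt_eqF.
  have top0 (z : R) : 0 < z -> z ^+ m / (z / (u + v)) ^+ m = (u + v) ^+ m.
    by move=> z0; rewrite -expr_div_n; congr (_ ^+ _); field; rewrite !gt_eqF.
  exists (u / (u + v)); split.
  - exact: divr_gt0.
  - by rewrite ltr_pdivrMr // mul1r ltrDl.
  - by rewrite e1 -uE -vE !top0.
  move=> a b a0 b0; set M := Num.min _ _; rewrite e1 in M *.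
  have lu : 0 < u / (u + v) by apply: divr_gt0.
  have lv : 0 < v / (u + v) by apply: divr_gt0.
  have M0 : 0 <= M by rewrite le_min !divr_ge0 ?ler0n ?exprn_ge0 ?ltW.
  (* Both l z and (1 - l) z, with z^m = M, are admissible radii for the two layers, and they add up
     to z. *)
  have [z z0 zE] := root_exists M0 m_gt0.
  have -> : M = (u / (u + v) * z + v / (u + v) * z) ^+ m.
    by rewrite -mulrDl -mulrDl divff ?mul1r ?zE // gt_eqF.
  apply: layF => //.
  - exact: mulr_ge0 (ltW lu) z0.
  - exact: mulr_ge0 (ltW lv) z0.
  - by rewrite exprMn -/m zE mulrC -ler_pdivlMr ?exprn_gt0 // ge_min lexx.
  - by rewrite exprMn -/m zE mulrC -ler_pdivlMr ?exprn_gt0 // ge_min lexx orbT.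
have l'0 : 0 < 1 - l by rewrite subr_gt0.
have lm := exprn_gt0 m l0; have l'm := exprn_gt0 m l'0.
have dec Z : forall a b, (a <= b)%N -> forall c : R, 0 < c ->
   #|` layer j Z b|%:R / c <= #|` layer j Z a|%:R / c.
  move=> a b ab c c0; rewrite ler_pM2r ?invr_gt0 // ler_nat.
  exact/fsubset_leq_card/layer_decr.
have := @merge_sum R (fun a => #|` layer j X a|%:R / l ^+ m)
  (fun b => #|` layer j Y b|%:R / (1 - l) ^+ m) F p q.
move=> /(_ _ _ top) H; apply: le_trans (H _ _ _); last first.
- by move=> a b ap bq; apply: minF; [apply: pN|apply: qN].
- by move=> a b ab; apply: dec.
- by move=> a b ab; apply: dec.
rewrite -!mulr_suml -!natr_sum cX cY.
apply: le_trans (radon m x0 y0 l0 l1) _.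
by rewrite lerD // ler_pM2r ?invr_gt0.
Qed.

End BrunnMinkowski.

(** * Lines in the directions of iterated images *)

Section IteratedImages.
Variables (V : zmodType) (f : {additive V -> V}).
Implicit Types (A B C : {fset V}).

Definition imiter j A : {fset V} := iter j (fun B : {fset V} => f @` B) A.

Lemma imiter_sumset j A B : imiter j (sumset A B) = sumset (imiter j A) (imiter j B).
Proof. by elim: j => //= j ->; rewrite imfset_sumset. Qed.

Lemma imiter_prog j t M : imiter j (prog t M) = prog (iter j f t) M.
Proof. by elim: j => //= j ->; rewrite imfset_prog. Qed.

Lemma imiterS j A B : A `<=` B -> imiter j A `<=` imiter j B.
Proof. by move=> AB; elim: j => //= j IH; apply: subset_imfset; apply/fsubsetP. Qed.

Lemma card_imiter j A : (#|` imiter j A| <= #|` A|)%N.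
Proof. by elim: j => //= j; apply: leq_trans; apply: leq_imfset_card. Qed.

Lemma nfoldM m n A : nfold m (nfold n A) = nfold (m * n) A.
Proof. by elim: m => // m IH; rewrite nfoldS IH mulSn nfoldD. Qed.

End IteratedImages.

Section IteratedGrowth.
Variable V : zmodType.
Implicit Types (f : {additive V -> V}) (A B C : {fset V}).

(** Covering f(A) by translates of D, indexed by a set T of size at most K, puts f(D) inside (T - T)
    + 2D. Iterating, f^j(D) lies in a number of translates of 2^j D that is bounded in terms of K
    and j. *)
Lemma imiter_diffset_cover K j : exists G, forall f A, A != fset0 ->
  (#|` sumset A (f @` A)| <= K * #|` A|)%N ->
  exists F, (#|` F| <= G)%N /\
    imiter f j (diffset A) `<=` sumset F (nfold (2 ^ j) (diffset A)).
Proof.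
elim: j => [|j [G IH]].
  exists 1%N => f A A0 leK; exists [fset 0]; rewrite cardfs1 sumset0l nfold1; split => //.
exists (G * (K * K) ^ (2 ^ j))%N => f A A0 leK.
have [T [_ cT TD]] := ruzsa_covering (f @` A) A0.
have {}cT : (#|` T| <= K)%N.
  by rewrite -(@leq_pmul2r #|` A|) ?cardfs_gt0 //; apply: leq_trans cT leK.
have oppS B C : B `<=` C -> oppset B `<=` oppset C.
  by move=> /fsubsetP BC; apply/fsubsetP => x; rewrite !mem_oppset; apply: BC.
have fD : f @` diffset A `<=` sumset (diffset T) (nfold 2 (diffset A)).
  rewrite imfset_diffset; apply: fsubset_trans (sumsetS TD (oppS _ _ TD)) _.
  by rewrite oppset_sumset oppset_diffset sumsetACA nfoldS nfold1.
have [F [cF FD]] := IH f A A0 leK.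
exists (sumset (f @` F) (nfold (2 ^ j) (diffset T))); split.
  apply: leq_trans (card_sumset _ _) _; apply: leq_mul.
    by apply: leq_trans cF; apply: leq_imfset_card.
  apply: leq_trans (card_nfold _ _) _; apply: leq_expn2r.
  apply: leq_trans (card_sumset _ _) _; apply: leq_mul => //.
  by rewrite /oppset card_inj_imfset //; apply: oppr_inj.
rewrite /=; apply: (@fsubset_trans _ (f @` sumset F (nfold (2 ^ j) (diffset A)))).
  by apply: subset_imfset; apply/fsubsetP.
rewrite imfset_sumset imfset_nfold -sumsetA; apply: sumsetS => //.
apply: fsubset_trans (nfoldSS _ fD) _.
by rewrite nfold_sumset nfoldM expnSr.
Qed.

Lemma imiter_growth K j : exists G, forall f A, injective f -> A != fset0 ->
  (#|` sumset A (f @` A)| <= K * #|` A|)%N ->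
  (#|` sumset (sumset A (f @` A)) (imiter f j (diffset A))| <= G * #|` A|)%N.
Proof.
have [G HG] := imiter_diffset_cover K j.
exists (K * G * K ^ (2 * (2 ^ j).+1 + 1))%N => f A f_inj A0 leK.
have [T [_ cT TD]] := ruzsa_covering (f @` A) A0.
have {}cT : (#|` T| <= K)%N.
  by rewrite -(@leq_pmul2r #|` A|) ?cardfs_gt0 //; apply: leq_trans cT leK.
have [F [cF FD]] := HG f A A0 leK.
have sub : sumset (sumset A (f @` A)) (imiter f j (diffset A)) `<=`
    sumset (sumset T F) (sumset (nfold (2 ^ j).+1 (diffset A)) A).
  apply: fsubset_trans (sumsetS (sumsetS (fsubset_refl A) TD) FD) _.
  by rewrite -(sumsetA A) sumsetACA (sumsetC A) -(sumsetA (sumset T F)) nfoldS.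
apply: leq_trans (fsubset_leq_card sub) _; apply: leq_trans (card_sumset _ _) _.
rewrite -mulnA; apply: leq_mul; last exact: dilate_growth leK.
by apply: leq_trans (card_sumset _ _) _; apply: leq_mul.
Qed.

End IteratedGrowth.

(** * Coordinates along lattice directions and Krylov matrices *)

Section Lattice.
Variable d : nat.
Local Notation V := 'cV[int]_d.
Implicit Types (L U : 'M[int]_d) (t v : V) (S X Y A : {fset V}).

Lemma mulmx_inj U : \det U != 0 -> injective (mulmx U : V -> V).
Proof.
move=> U0 v w /(congr1 (mulmx (\adj U))); rewrite !mulmxA mul_adj_mx !mul_scalar_mx.
move=> e; apply/matrixP => i j; have := congr1 (fun M : V => M i j) e.
by rewrite !mxE => /(mulfI U0).
Qed.

Lemma adjmx_inj U : \det U != 0 -> injective (mulmx (\adj U) : V -> V).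
Proof.
move=> U0 v w /(congr1 (mulmx U)); rewrite !mulmxA mul_mx_adj !mul_scalar_mx.
move=> e; apply/matrixP => i j; have := congr1 (fun M : V => M i j) e.
by rewrite !mxE => /(mulfI U0).
Qed.

(** Multiplication by [\adj U] turns column j of U into a multiple of the j-th unit vector, so the
    projection counts the lines of S parallel to that column. One chosen point on each line, moved
    by M different multiples of the column, gives distinct points. *)
Lemma lines_card U S j M : \det U != 0 ->
  (#|` proj j @` (mulmx (\adj U) @` S)| * M <= #|` sumset S (prog (col j U) M)|)%N.
Proof.
move=> U0; set f := mulmx (\adj U).
have fu : f (col j U) = \det U *: delta_mx j 0.
  by rewrite /f colE mulmxA mul_adj_mx mul_scalar_mx.
have fE v c : f (v + col j U *+ c) = f v + (\det U *: delta_mx j 0) *+ c.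
  by rewrite /f raddfD raddfMn /= -/f fu.
have sec (w : V) : exists s : V, w \in proj j @` (f @` S) -> s \in S /\ proj j (f s) = w.
  have [/imfsetP[_ /= /imfsetP[s /= sS ->] ->]|_] := boolP (w \in _); last by exists 0.
  by exists s.
have [s sP] := choice sec.
have cM : #|` [fset c in iota 0 M]| = M by rewrite card_fseq undup_id ?iota_uniq ?size_iota.
rewrite -{1}cM -card_fsetM.
apply: (card_fset_inj (f := fun p => s p.1 + col j U *+ p.2)); last first.
  move=> [w c]; rewrite in_fsetM !inE /= mem_iota => /andP[/sP[sS _] cM'].
  by rewrite mem_sumset //; apply/progP; exists c.
have fpc (w : V) c : w \in proj j @` (f @` S) -> proj j (f (s w + col j U *+ c)) = w.
  move=> /sP[_ {2}<-]; rewrite fE; move: (f (s w)) => a.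
  apply/matrixP => i l; rewrite ord1 !projE; case: eqP => // /eqP ij.
  by rewrite mxE mulmxnE !mxE (negPf ij) mulr0 mul0rn addr0.
move=> [w c] [w' c']; rewrite !in_fsetM /= => /andP[wS _] /andP[w'S _] /= e.
have ew : w = w' by rewrite -(fpc w c wS) e fpc.
move: e; rewrite ew => /(congr1 f); rewrite !fE => /addrI /matrixP /(_ j 0).
by rewrite !mulmxnE !mxE !eqxx mulr1 => /(mulrIn U0) ->.
Qed.

Lemma BM_lines (R : realType) : exists C, forall U X Y (x y : R), \det U != 0 ->
  X != fset0 -> Y != fset0 -> 0 <= x -> 0 <= y ->
  x ^+ d <= #|` X|%:R -> y ^+ d <= #|` Y|%:R ->
  (x + y) ^+ d <= (#|` sumset X Y| +
     C * \sum_(j < d) #|` proj j @` (mulmx (\adj U) @` sumset X Y)|)%:R.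
Proof.
have [C HC] := boxsize_le (enum_uniq 'I_d); exists C => U X Y x y U0 X0 Y0 x0 y0 xX yY.
have inj := adjmx_inj U0; pose f := mulmx (\adj U) : V -> V.
have f0 Z : Z != fset0 -> f @` Z != fset0.
  by rewrite -!cardfs_gt0 card_inj_imfset.
have sup (Z : {fset V}) : forall v : V, v \in Z -> forall i, i \notin enum 'I_d -> v i 0 = 0.
  by move=> v _ i; rewrite mem_enum.
have sz : size (enum 'I_d) = d by rewrite size_enum_ord.
have := @boxsize_BM R d (enum 'I_d) (f @` X) (f @` Y) x y (f0 _ X0) (f0 _ Y0)
  (sup _) (sup _) x0 y0.
rewrite sz !card_inj_imfset // => /(_ xX yY) /le_trans; apply.
rewrite ler_nat -imfset_sumset; apply: leq_trans (HC _) _.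
by rewrite card_inj_imfset // big_enum.
Qed.

(** The Krylov matrix, with columns t, Lt, ..., L^(d-1) t. Its determinant being non-zero for all
    non-zero t is the form in which irreducibility is used: every such t is a cyclic vector. *)
Definition kry L t : 'M[int]_d := \matrix_(i, j) (iter j (mulmx L) t) i 0.
Definition irred L := forall t, t != 0 -> \det (kry L t) != 0.

Lemma col_kry L t j : col j (kry L t) = iter j (mulmx L) t.
Proof. by apply/matrixP => i l; rewrite ord1 !mxE. Qed.

End Lattice.

(** This s converts a saving of sqrt 2 per binary digit into a power of |A|, where |A| is about r^m
    for m digits. *)
Lemma exists_root_exponent (R : realType) (r : nat) : (1 < r)%N ->
  exists s : R, [/\ 0 < s, s < 1 & (r%:R : R) `^ s = Num.sqrt 2].
Proof.
move=> r1; have s2 : 1 < Num.sqrt (2 : R) by rewrite -{1}sqrtr1 ltr_sqrt // ltr1n.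
have s2r : Num.sqrt (2 : R) < r%:R.
  rewrite (@lt_le_trans _ _ 2) ?ler_nat //.
  by rewrite -{2}(sqr_sqrtr (ler0n R 2)) ltr_eXnr.
have r0 : (0 : R) < r%:R by rewrite ltr0n; apply: leq_trans r1.
have lr : 0 < ln (r%:R : R) by rewrite ln_gt0 // ltr1n.
exists (ln (Num.sqrt 2) / ln r%:R); split.
- by rewrite divr_gt0 // ln_gt0.
- by rewrite ltr_pdivrMr // mul1r ltr_ln ?posrE // (lt_trans _ s2).
- by rewrite /powR gt_eqF // divfK ?gt_eqF // lnK // posrE (lt_trans _ s2).
Qed.

Lemma card_le_expn_sqrt2 (R : realType) (z n : nat) : (z ^ 2 <= 2 ^ n)%N ->
  (z%:R : R) <= Num.sqrt 2 ^+ n.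
Proof.
move=> le; rewrite -(@ler_pXn2r _ 2) ?nnegrE ?exprn_ge0 ?sqrtr_ge0 ?ler0n //.
by rewrite -exprM mulnC exprM sqr_sqrtr ?ler0n // -!natrX ler_nat.
Qed.

Lemma powR_trade (R : realType) (r N m : nat) (s : R) : (0 < N)%N -> (0 < r)%N -> 0 < s ->
  (r%:R : R) `^ s = Num.sqrt 2 -> (N <= r ^ m)%N ->
  N%:R <= Num.sqrt 2 ^+ m * (N%:R : R) `^ (1 - s).
Proof.
move=> N0 r0 s0 rs le.
have e : N%:R = (N%:R : R) `^ s * N%:R `^ (1 - s).
  by rewrite -powRD ?subrKC ?powRr1 // pnatr_eq0 -lt0n N0 implybT.
rewrite {1}e ler_wpM2r ?powR_ge0 //.
apply: (@le_trans _ _ ((r ^ m)%:R `^ s)); first by rewrite ge0_ler_powR ?nnegrE ?ler_nat // ltW.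
by rewrite -rs natrX -(powR_mulrn m (ler0n R r)) -(powR_mulrn m (powR_ge0 _ s)) -!powRrM mulrC.
Qed.

(** * Brunn-Minkowski for a set and its dilate *)

Section DilateBM.
Variables (R : realType) (d : nat).
Local Notation V := 'cV[int]_d.

(** The progression P absorbed by D in direction t is carried by L^j to direction L^j t, with no
    more translates. With S = A + LA, the size of S + L^j P is bounded below by the number of lines
    of S in that direction and above by [imiter_growth]. The directions are the columns of
    [kry L t]. *)
Lemma dilate_lines (K : nat) : exists (G : 'I_d -> nat) q r, (0 < q)%N /\ (1 < r)%N /\
  forall (L : 'M[int]_d) (A : {fset V}), irred L -> \det L != 0 -> A != fset0 ->
  (#|` sumset A (mulmx L @` A)| <= K * #|` A|)%N ->
  forall n, (r ^ (q * n) < #|` A|)%N ->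
  exists U z, [/\ \det U != 0, (z ^ 2 <= 2 ^ (q * n))%N & forall j,
    (#|` proj j @` (mulmx (\adj U) @` sumset A (mulmx L @` A))| * 2 ^ (q * n)
      <= z * (G j * #|` A|))%N].
Proof.
have [G HG] := fin_all_exists (fun j : 'I_d => imiter_growth V K j).
have [q [r [q0 [r1 LP]]]] := long_progression V K.
exists G, q, r; split=> //; split=> // L A irrL L0 A0 leK n ltn.
have L_inj := mulmx_inj L0.
have [t [Z [t0 cZ DZ]]] := LP A A0 (fun m => dilate_growth m L_inj A0 leK) n ltn.
exists (kry L t), #|` Z|; split=> //; first exact: irrL.
move=> j; apply: leq_trans (lines_card _ _ _ (irrL _ t0)) _.
rewrite col_kry -(imiter_prog (mulmx L)).
set S := sumset A _; set P := prog t _ in DZ *; pose D := diffset A.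
have sub : sumset S (imiter (mulmx L) j P) `<=`
    sumset (imiter (mulmx L) j Z) (sumset S (imiter (mulmx L) j D)).
  rewrite (sumsetA (imiter _ j Z)) (sumsetC (imiter _ j Z) S) -(sumsetA S) -imiter_sumset.
  apply: sumsetS => //; apply: imiterS; apply: fsubset_trans DZ.
  by rewrite -{1}[P]sumset0l; apply: sumsetS => //; rewrite fsub1set diffset_mem0.
apply: leq_trans (fsubset_leq_card sub) _; apply: leq_trans (card_sumset _ _) _.
by apply: leq_mul; [apply: card_imiter | apply: HG].
Qed.

(** Each line count is at most z G_j |A| / 2^(qn) with z <= 2^(qn/2); for maximal n this is a
    constant times |A|^(1 - s). *)
Lemma dilate_BM (K : nat) : exists E s : R, [/\ 0 < E, 0 < s, s < 1 &
  forall (L : 'M[int]_d) (A X : {fset V}) (x y : R), irred L -> \det L != 0 ->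
  X `<=` A -> X != fset0 -> (#|` sumset A (mulmx L @` A)| <= K * #|` A|)%N ->
  0 <= x -> 0 <= y -> x ^+ d <= #|` X|%:R -> y ^+ d <= #|` A|%:R ->
  (x + y) ^+ d <= #|` sumset X (mulmx L @` A)|%:R + E * #|` A|%:R `^ (1 - s)].
Proof.
have [C HC] := BM_lines d R.
have [G [q [r [q0 [r1 HG]]]]] := dilate_lines K.
have [s [s0 s1 rs]] := exists_root_exponent R r1.
pose w : R := Num.sqrt 2; pose sG : R := \sum_(j < d) (G j)%:R.
have w0 : 0 < w by rewrite sqrtr_gt0.
have sG0 : 0 <= sG by apply: sumr_ge0 => j _; apply: ler0n.
pose E1 := C%:R * (sG * w ^+ q); pose E2 : R := C%:R * (d%:R * K%:R).
have E10 : 0 <= E1 by rewrite !mulr_ge0 ?ler0n ?exprn_ge0 // ltW.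
have E20 : 0 <= E2 by rewrite !mulr_ge0 ?ler0n.
exists (E1 + E2 + 1), s; split=> //; first by lra.
move=> L A X x y irrL L0 XA X0 leK x0 y0 xX yA.
have A0 : A != fset0 by apply: fsubset_neq0 XA X0.
have N0 : (0 < #|` A|)%N by rewrite cardfs_gt0.
have LA0 : mulmx L @` A != fset0 by rewrite -cardfs_gt0 card_inj_imfset //; apply: mulmx_inj.
have {}yA : y ^+ d <= #|` mulmx L @` A|%:R by rewrite card_inj_imfset //; apply: mulmx_inj.
set S := sumset X _; have SA : S `<=` sumset A (mulmx L @` A) by apply: sumsetS.
have P0 : 0 <= (#|` A|%:R : R) `^ (1 - s) by apply: powR_ge0.
suff [U U0 le] : exists2 U : 'M[int]_d, \det U != 0 &
    C%:R * \sum_(j < d) #|` proj j @` (mulmx (\adj U) @` S)|%:R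
      <= (E1 + E2 + 1) * (#|` A|%:R : R) `^ (1 - s).
  apply: le_trans (HC U X _ x y U0 X0 LA0 x0 y0 xX yA) _.
  by rewrite natrD natrM natr_sum lerD2l.
have [N1|N2] := leqP #|` A| 1.
  have e1 : #|` A| = 1%N by apply/eqP; rewrite eqn_leq N1.
  exists 1%:M; first by rewrite det1.
  rewrite e1 powR1 mulr1; apply: (@le_trans _ _ E2); last by lra.
  rewrite /E2 ler_wpM2l ?ler0n //.
  apply: (@le_trans _ _ (\sum_(j < d) K%:R)); last by rewrite sumr_const card_ord mulr_natl.
  apply: ler_sum => j _; rewrite ler_nat.
  apply: leq_trans (leq_imfset_card _ _ _) _; apply: leq_trans (leq_imfset_card _ _ _) _.
  by apply: leq_trans (fsubset_leq_card SA) _; rewrite e1 muln1 in leK.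
(* For the largest admissible n, |A| is at most r^(q(n + 1)); the one block in excess accounts for
   the factor w^q in [E1]. *)
have [n ltn geN] : exists2 n, (r ^ (q * n) < #|` A|)%N & (#|` A| <= r ^ (q * n.+1))%N.
  have ex : exists n, (r ^ (q * n) < #|` A|)%N by exists 0%N; rewrite muln0.
  have bd n : (r ^ (q * n) < #|` A|)%N -> (n <= #|` A|)%N.
    move=> h; apply: ltnW; apply: leq_ltn_trans h.
    by apply: leq_trans (ltnW (ltn_expl _ r1)); rewrite leq_pmull.
  case: (ex_maxnP ex bd) => n ltn nmax; exists n => //.
  by rewrite leqNgt; apply/negP => /nmax; rewrite ltnn.
have [U [z [U0 zn Hl]]] := HG L A irrL L0 A0 leK n ltn.
exists U => //.
have trade := powR_trade N0 (ltnW r1) s0 rs geN.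
have zw := card_le_expn_sqrt2 R zn; rewrite -/w in zw trade.
have wn : 0 < w ^+ (q * n) by apply: exprn_gt0.
have lj j : (#|` proj j @` (mulmx (\adj U) @` S)|%:R : R) <=
    (G j)%:R * w ^+ q * #|` A|%:R `^ (1 - s).
  apply: (@le_trans _ _ #|` proj j @` (mulmx (\adj U) @` sumset A (mulmx L @` A))|%:R).
    rewrite ler_nat; apply/fsubset_leq_card; apply: subset_imfset => v /imfsetP[u /= uS ->].
    by rewrite in_imfset //; apply: (fsubsetP SA).
  have := Hl j; rewrite -(ler_nat R) !natrM natrX.
  set l := (#|` proj j @` _|%:R : R) => h.
  have e2 : (2%:R : R) ^+ (q * n) = w ^+ (q * n) * w ^+ (q * n).
    by rewrite -exprMn -expr2 sqr_sqrtr // ler0n.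
  have {h} : l * w ^+ (q * n) <= (G j)%:R * #|` A|%:R.
    rewrite -(@ler_pM2r _ (w ^+ (q * n))) // -mulrA -e2; apply: le_trans h _.
    by rewrite mulrC ler_wpM2l // mulr_ge0 ?ler0n.
  move=> h; rewrite -(@ler_pM2r _ (w ^+ (q * n))) //; apply: le_trans h _.
  rewrite -!mulrA ler_wpM2l ?ler0n //; apply: le_trans trade _.
  by rewrite mulnS exprD -mulrA (mulrC (w ^+ (q * n))).
apply: (@le_trans _ _ (E1 * (#|` A|%:R : R) `^ (1 - s))); last first.
  by rewrite ler_wpM2r //; lra.
rewrite /E1 -!mulrA ler_wpM2l ?ler0n // mulr_suml; apply: ler_sum => j _.
by rewrite mulrA.
Qed.
End DilateBM.

Lemma absz_unit (u : int) : u \is a GRing.unit -> `|u|%N = 1%N.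
Proof.
move=> uU; have /(congr1 absz) := divrr uU; rewrite abszM /= => /eqP.
by rewrite muln_eq1 => /andP[/eqP].
Qed.

(** * Cosets of the image lattice *)

Section Cosets.
Variable d : nat.
Local Notation V := 'cV[int]_d.
Implicit Types (L U : 'M[int]_d) (t v : V) (S X Y A B : {fset V}).

(** A system of representatives of Z^d modulo L Z^d, given by a choice function on Z^d in place of a
    quotient group. *)
Record coset_reps L (rep : V -> V) (Rp : {fset V}) : Prop := CosetReps {
  rep_card : #|` Rp| = `|\det L|%N;
  rep_in : forall x, rep x \in Rp;
  rep_eq : forall x, exists y, x = rep x + L *m y;
  rep_shift : forall x y, rep (x + L *m y) = rep x;
  rep_fix : forall r, r \in Rp -> rep r = r }.

Lemma smith_square L : exists P Q (e : 'rV[int]_d),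
  [/\ P \in unitmx, Q \in unitmx & L = P *m diag_mx e *m Q].
Proof.
have [P PU [Q QU [s _ eL]]] := int_Smith_normal_form L.
exists P, Q, (\row_i s`_i); split=> //; rewrite {1}eL; congr (_ *m _ *m _).
by apply/matrixP => i j; rewrite !mxE.
Qed.

(** In the Smith form L = P diag(e) Q the cosets are the tuples of residues modulo the e_i in the
    coordinates given by P, and there are |e_1 ... e_d| = |det L| of them. *)
Lemma coset_reps_exist L : \det L != 0 -> exists rep Rp, coset_reps L rep Rp.
Proof.
move=> L0; have [P [Q [e [PU QU eL]]]] := smith_square L.
have detL : `|\det L|%N = (\prod_i `|e 0%R i|)%N.
  have unit1 M : M \in unitmx -> `|\det M|%N = 1%N by rewrite unitmxE => /absz_unit.
  rewrite eL !det_mulmx det_diag !abszM !unit1 // mul1n muln1.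
  exact: (big_morph absz abszM).
have e0 i : e 0 i != 0.
  apply: contraNneq L0 => ei; rewrite eL !det_mulmx det_diag (bigD1 i) //= ei.
  by rewrite mul0r mulr0 mul0r.
pose F := {dffun forall i : 'I_d, 'I_(`|e 0%R i|%N)}.
pose g (f : F) : V := P *m \col_i (f i : nat)%:Z.
pose rep (x : V) : V := P *m \col_i ((invmx P *m x)%R i 0%R %% e 0%R i)%Z.
exists rep, (g @` [fset f in (predT : pred F)]); split.
- rewrite card_inj_imfset.
    rewrite (card_finset (predT : pred F)) card_dep_ffun detL foldrE big_map big_enum /=.
    by apply: eq_bigr => i _; rewrite card_ord.
  move=> f f' /(congr1 (mulmx (invmx P))); rewrite !mulKmx // => /matrixP ef.
  apply/ffunP => i; apply: val_inj; have := ef i 0; rewrite !mxE => -[] //.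
- move=> x; apply/imfsetP.
  have lt i : (`|((invmx P *m x)%R i 0%R %% e 0%R i)%Z|%N < `|e 0%R i|%N)%N.
    by rewrite -ltz_nat gez0_abs ?modz_ge0 // abszE ltz_mod.
  exists [ffun i => Ordinal (lt i)]; first by rewrite !inE.
  rewrite /rep /g; congr (_ *m _); apply/matrixP => i j; rewrite mxE [RHS]mxE ffunE /=.
  by rewrite gez0_abs ?modz_ge0.
- move=> x; exists (invmx Q *m \col_i ((invmx P *m x)%R i 0%R %/ e 0%R i)%Z).
  rewrite {1}eL !mulmxA mulmxK // /rep -mulmxA -mulmxDr.
  rewrite -{1}(mulKVmx PU x); congr (_ *m _); apply/matrixP => i j.
  by rewrite ord1 mul_diag_mx !mxE addrC mulrC -divz_eq.
- move=> x y; rewrite /rep; congr (_ *m _); apply/matrixP => i j.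
  rewrite mxE [RHS]mxE mulmxDr {1}eL -!mulmxA mulKmx // mxE mul_diag_mx addrC.
  by rewrite [X in X + _]mxE mulrC modzMDl.
- move=> _ /imfsetP[f _ ->]; rewrite /rep /g mulKmx //; congr (_ *m _).
  apply/matrixP => i j; rewrite !mxE -modz_abs modz_small //.
  by rewrite lez_nat ltz_nat /=.
Qed.

Definition cls (rep : V -> V) A r : {fset V} := [fset a in A | rep a == r].

Lemma in_cls rep A r x : (x \in cls rep A r) = (x \in A) && (rep x == r).
Proof. by rewrite !inE. Qed.

Lemma cls_sub rep A r : cls rep A r `<=` A.
Proof. exact: fset_sub. Qed.

Section WithReps.
Variables (L : 'M[int]_d) (rep : V -> V) (Rp : {fset V}).
Hypothesis L0 : \det L != 0.
Hypothesis HR : coset_reps L rep Rp.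

Lemma card_cls A : #|` A| = (\sum_(r <- Rp) #|` cls rep A r|)%N.
Proof. by apply: card_fset_partition => x _; apply: rep_in HR _. Qed.

(** Adding LA does not leave the coset of r, so the summands partition A + LA. *)
Lemma card_sum_cls A : #|` sumset A (mulmx L @` A)| =
  (\sum_(r <- Rp) #|` sumset (cls rep A r) (mulmx L @` A)|)%N.
Proof.
rewrite [LHS]card_cls; apply: eq_bigr => r _; congr #|` _|.
apply/fsetP => x; rewrite in_cls; apply/andP/sumsetP.
  move=> [/sumsetP[a [b [aA bA ->]]]]; have /imfsetP[b' /= b'A ->] := bA.
  by rewrite (rep_shift HR) => ar; exists a, (L *m b'); rewrite in_cls aA ar in_imfset.
move=> [a [b [aA bA ->]]]; move: aA; rewrite in_cls => /andP[aA ar].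
split; first exact: mem_sumset.
by have /imfsetP[b' /= b'A ->] := bA; rewrite (rep_shift HR).
Qed.

Lemma cls_dilate A r : exists B, cls rep A r = sumset [fset r] (mulmx L @` B).
Proof.
have [f fP] := choice (rep_eq HR).
exists (f @` cls rep A r); apply/fsetP => x; apply/idP/sumsetP.
  move=> xA; exists r, (L *m f x); split; [exact: fset11| |].
    by do 2!apply: in_imfset.
  by move: xA; rewrite in_cls => /andP[_ /eqP<-]; rewrite -fP.
move=> [_ [_ [/fset1P-> /imfsetP[_ /= /imfsetP[a aA ->] ->] ->]]].
have {}aA : a \in cls rep A r := aA.
by have := aA; rewrite in_cls => /andP[_ /eqP er]; rewrite -{1}er -fP.
Qed.

Lemma card_dilate r B : #|` sumset [fset r] (mulmx L @` B)| = #|` B|.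
Proof. by rewrite card_translate card_inj_imfset //; apply: mulmx_inj. Qed.

Lemma card_sum_dilate r B : let A := sumset [fset r] (mulmx L @` B) in
  #|` sumset A (mulmx L @` A)| = #|` sumset B (mulmx L @` B)|.
Proof.
rewrite /= imfset_sumset sumsetACA -imfset_sumset imfset_fset1.
have -> : sumset [fset r] [fset L *m r] = [fset r + L *m r].
  apply/fsetP => x; rewrite inE; apply/sumsetP/eqP => [[a [b [/fset1P-> /fset1P-> ->]]] //|->].
  by exists r, (L *m r); rewrite !fset11.
exact: card_dilate.
Qed.

End WithReps.
End Cosets.

(** * The defect of a set *)

Section PowerInequalities.
Variable R : realType.
Implicit Types a b s x y k : R.

Lemma expr_shift_diff a b s n : 0 <= a -> a <= b -> 0 <= s ->
  b ^+ n - a ^+ n <= (s + b) ^+ n - (s + a) ^+ n.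
Proof.
move=> a0 ab s0; have b0 := le_trans a0 ab.
elim: n => [|n IH]; first by rewrite !expr0 !subrr.
have e u v : u ^+ n.+1 - v ^+ n.+1 = u * (u ^+ n - v ^+ n) + (u - v) * v ^+ n :> R.
  by rewrite !exprS; ring.
rewrite !e; apply: lerD.
  apply: ler_pM => //; last by rewrite lerDr.
  by rewrite subr_ge0 lerXn2r.
have -> : s + b - (s + a) = b - a by ring.
by rewrite ler_wpM2l ?subr_ge0 // lerXn2r ?nnegrE ?addr_ge0 // lerDr.
Qed.

(** The increment of the n-th power from kx to y grows under a shift by x. In the application x^n =
    |X| and y^n = |A|, and the second summand is the gain of a class below average size. *)
Lemma bm_small x y k n : 0 <= x -> 0 <= y -> 0 <= k -> k * x <= y ->
  (1 + k) ^+ n * x ^+ n + (y ^+ n - k ^+ n * x ^+ n) <= (x + y) ^+ n.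
Proof.
move=> x0 y0 k0 kxy.
have := @expr_shift_diff (k * x) y x n (mulr_ge0 k0 x0) kxy x0.
by rewrite -!exprMn mulrDl mul1r; lra.
Qed.

Lemma bm_large x y k n : 0 <= x -> 0 <= y -> 0 < k -> y <= k * x ->
  (1 + k) ^+ n / k ^+ n * y ^+ n <= (x + y) ^+ n.
Proof.
move=> x0 y0 k0 yx; rewrite -expr_div_n -exprMn.
have -> : (1 + k) / k * y = y / k + y by field; rewrite gt_eqF.
apply: lerXn2r; rewrite ?nnegrE ?addr_ge0 ?divr_ge0 ?(ltW k0) //.
by rewrite lerD2r ler_pdivrMr // mulrC.
Qed.

End PowerInequalities.

Section Defect.
Variables (R : realType) (d k : nat) (kap : R).
Hypothesis d0 : (0 < d)%N.
Hypothesis kap0 : 0 < kap.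
Hypothesis kapE : kap ^+ d = k%:R.
Local Notation V := 'cV[int]_d.
Implicit Types (L : 'M[int]_d) (A B X : {fset V}).

Let c : R := (1 + kap) ^+ d.

Definition defect L A : R := c * #|` A|%:R - #|` sumset A (mulmx L @` A)|%:R.

Lemma index_gt0 : (0 : R) < k%:R.
Proof. by rewrite -kapE exprn_gt0. Qed.

Lemma slope_gt0 : 0 < c.
Proof. by rewrite exprn_gt0 // addr_gt0. Qed.

Section Full.
Variables (K : nat) (E s : R).
Hypothesis cK : c <= K%:R.
Hypothesis E0 : 0 < E.
Hypothesis HBM : forall L A X (x y : R), irred L -> \det L != 0 ->
  X `<=` A -> X != fset0 -> (#|` sumset A (mulmx L @` A)| <= K * #|` A|)%N ->
  0 <= x -> 0 <= y -> x ^+ d <= #|` X|%:R -> y ^+ d <= #|` A|%:R ->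
  (x + y) ^+ d <= #|` sumset X (mulmx L @` A)|%:R + E * #|` A|%:R `^ (1 - s).

(** A positive defect means |A + LA| < c|A|, the small doubling that [HBM] asks for. The two cases
    compare |X| with the average class size |A| / k. *)
Lemma class_bounds L A X : irred L -> \det L != 0 -> X `<=` A -> X != fset0 ->
  0 < defect L A ->
  let S := #|` sumset X (mulmx L @` A)|%:R + E * #|` A|%:R `^ (1 - s) in
  (k%:R * #|` X|%:R <= #|` A|%:R :> R ->
     c * #|` X|%:R + (#|` A|%:R - k%:R * #|` X|%:R) <= S) /\
  (#|` A|%:R <= k%:R * #|` X|%:R :> R -> c / k%:R * #|` A|%:R <= S).
Proof.
move=> irrL L0 XA X0 def0 S.
have leK : (#|` sumset A (mulmx L @` A)| <= K * #|` A|)%N.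
  rewrite -(ler_nat R) natrM; apply: (@le_trans _ _ (c * #|` A|%:R)).
    by move: def0; rewrite /defect subr_gt0 => /ltW.
  by rewrite ler_wpM2r.
have [x x0 xE] := root_exists (ler0n R #|` X|) d0.
have [y y0 yE] := root_exists (ler0n R #|` A|) d0.
have := HBM irrL L0 XA X0 leK x0 y0; rewrite xE yE !lexx => /(_ isT isT) le.
have kx : (k%:R * #|` X|%:R <= #|` A|%:R :> R) = (kap * x <= y).
  by rewrite -kapE -xE -yE -exprMn ler_pXn2r // nnegrE mulr_ge0 // ltW.
have yx : (#|` A|%:R <= k%:R * #|` X|%:R :> R) = (y <= kap * x).
  by rewrite -kapE -xE -yE -exprMn ler_pXn2r // nnegrE mulr_ge0 // ltW.
split=> [|]; rewrite ?kx ?yx => h; apply: le_trans le.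
  by have := bm_small d x0 y0 (ltW kap0) h; rewrite xE yE kapE.
by have := bm_large d x0 y0 kap0 h; rewrite yE kapE.
Qed.

(** Let Y be the total shortfall of the small classes. Up to k e the defect is at most C Y, by
    Brunn-Minkowski on every class, and at most B - Y, where large classes use their own defects.
    Adding C times the second bound to the first eliminates Y and leaves the factor C / (1 + C). *)
Lemma full_defect L rep Rp A (b : V -> R) : irred L -> \det L != 0 -> `|\det L|%N = k ->
  coset_reps L rep Rp -> (forall r, r \in Rp -> cls rep A r != fset0) ->
  (forall r, r \in Rp -> 0 <= b r) ->
  (forall r, r \in Rp -> #|` A|%:R <= k%:R * #|` cls rep A r|%:R :> R ->
     defect L (cls rep A r) <= b r) ->
  defect L A <= (c / k%:R) / (1 + c / k%:R) *
      (\sum_(r <- Rp | (#|` A|%:R <= k%:R * #|` cls rep A r|%:R :> R)) b r) +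
    k%:R * (E * #|` A|%:R `^ (1 - s)).
Proof.
move=> irrL L0 detk HR full b0 hb.
pose N : R := #|` A|%:R; pose n r : R := #|` cls rep A r|%:R.
pose lg r := N <= k%:R * n r.
set e := E * _; set C := c / k%:R.
have C0 : 0 < C by rewrite divr_gt0 ?slope_gt0 ?index_gt0.
have e0 : 0 <= e by rewrite mulr_ge0 ?powR_ge0 // ltW.
set B := \sum_(r <- Rp | _) b r.
have B0 : 0 <= B by rewrite /B big_seq_cond; apply: sumr_ge0 => r /andP[rR _]; apply: b0.
have rho0 : 0 <= C / (1 + C) by rewrite divr_ge0 ?addr_ge0 ?ler01 // ltW.
have [def0|def0] := leP (defect L A) 0.
  apply: le_trans def0 _; apply: addr_ge0; first exact: mulr_ge0.
  exact: mulr_ge0 (ltW index_gt0) e0.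
pose S r : R := #|` sumset (cls rep A r) (mulmx L @` A)|%:R.
have sumS : #|` sumset A (mulmx L @` A)|%:R = \sum_(r <- Rp) S r.
  by rewrite (card_sum_cls HR) natr_sum.
have sumn : N = \sum_(r <- Rp) n r by rewrite /N (card_cls HR) natr_sum.
have sum1 (z : R) : \sum_(r <- Rp) z = k%:R * z.
  by rewrite big_const_seq count_predT iter_addr_0 (rep_card HR) detk mulr_natl.
pose Y := \sum_(r <- Rp | ~~ lg r) (N - k%:R * n r).
(* There are k classes, so the deviations from the average cancel: the surplus of the large classes
   equals the shortfall of the small ones. *)
have YE : \sum_(r <- Rp | lg r) (k%:R * n r - N) = Y.
  have : \sum_(r <- Rp) (N - k%:R * n r) = 0.
    by rewrite sumrB sum1 -mulr_sumr -sumn subrr.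
  rewrite (bigID lg) /= -/Y => /eqP; rewrite addrC addr_eq0 => /eqP ->.
  by rewrite -sumrN; apply: eq_bigr => r _; rewrite opprB.
have bnd r : r \in Rp -> (~~ lg r -> c * n r + (N - k%:R * n r) <= S r + e) /\
    (lg r -> C * N <= S r + e).
  move=> rR; have [h1 h2] := class_bounds irrL L0 (cls_sub rep A r) (full r rR) def0.
  by split=> [|//]; rewrite -ltNge => /ltW.
have cN : c * N = \sum_(r <- Rp) c * n r by rewrite sumn mulr_sumr.
have defE : defect L A = \sum_(r <- Rp) c * n r - \sum_(r <- Rp) S r.
  by rewrite /defect -/N cN sumS.
have key (g h : V -> R) : (forall r, r \in Rp -> lg r -> c * n r <= S r + g r + e) ->
    (forall r, r \in Rp -> ~~ lg r -> c * n r <= S r + h r + e) ->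
    defect L A <= \sum_(r <- Rp | lg r) g r + \sum_(r <- Rp | ~~ lg r) h r + k%:R * e.
  move=> hg hh; rewrite defE -sum1 lerBlDl addrA.
  have -> : \sum_(r <- Rp | lg r) g r + \sum_(r <- Rp | ~~ lg r) h r =
      \sum_(r <- Rp) (if lg r then g r else h r).
    rewrite [RHS](bigID lg) /=; congr (_ + _); apply: eq_bigr => r; first by move=> ->.
    by move=> /negPf ->.
  rewrite -!big_split /= big_seq [leRHS]big_seq; apply: ler_sum => r rR.
  by case: ifP => [|/negbT]; [apply: hg | apply: hh].
have bound1 : defect L A <= C * Y + k%:R * e.
  apply: le_trans (key (fun r => C * (k%:R * n r - N)) (fun=> 0) _ _) _.
  - move=> r rR lr; have [_ /(_ lr)] := bnd r rR.
    have -> : C * (k%:R * n r - N) = c * n r - C * N.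
      by rewrite mulrBr mulrA divfK // gt_eqF // index_gt0.
    by lra.
  - move=> r rR sr; have [/(_ sr) h _] := bnd r rR.
    by move: sr; rewrite /lg -ltNge; lra.
  - by rewrite [X in _ + X + _]big1 // addr0 -mulr_sumr YE.
have bound2 : defect L A <= B - Y + k%:R * e.
  apply: le_trans (key b (fun r => - (N - k%:R * n r)) _ _) _.
  - move=> r rR lr; have := hb r rR lr; rewrite /defect -/(n r).
    have : #|` sumset (cls rep A r) (mulmx L @` cls rep A r)|%:R <= S r.
      rewrite ler_nat; apply: card_sumsetS; apply: subset_imfset.
      by apply/fsubsetP/cls_sub.
    by lra.
  - by move=> r rR sr; have [/(_ sr) h _] := bnd r rR; lra.
  - by rewrite sumrN.
have C10 : 0 < 1 + C by rewrite addr_gt0.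
have -> : C / (1 + C) * B + k%:R * e = (C * B + (1 + C) * (k%:R * e)) / (1 + C).
  by field; rewrite gt_eqF.
rewrite ler_pdivlMr //.
have h1 := ler_wpM2l (ltW C0) bound2.
move: bound1 h1; rewrite (_ : C * (B - Y + k%:R * e) = C * B - C * Y + C * (k%:R * e)); last by ring.
rewrite (_ : defect L A * (1 + C) = defect L A + C * defect L A); last by ring.
rewrite (_ : (1 + C) * (k%:R * e) = k%:R * e + C * (k%:R * e)); last by ring.
lra.
Qed.

End Full.
End Defect.

(** * Primitive sets *)

Section Normalisation.
Variable d : nat.
Local Notation V := 'cV[int]_d.
Implicit Types (L P : 'M[int]_d) (A B : {fset V}).

(** A - A generates Z^d modulo L Z^d. Subgroups are encoded as predicates closed under
    subtraction. *)
Definition primitive L A := forall Q : V -> Prop,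
  (forall x y, Q x -> Q y -> Q (x - y)) -> (forall y, Q (L *m y)) ->
  (forall a b, a \in A -> b \in A -> Q (a - b)) -> forall x, Q x.

Lemma subgroup_mulmx n (M : 'M[int]_(d, n)) (Q : V -> Prop) :
  Q 0 -> (forall x y, Q x -> Q y -> Q (x - y)) -> (forall j, Q (col j M)) ->
  forall z, Q (M *m z).
Proof.
move=> Q0 QB Qc z.
have QN x : Q x -> Q (- x) by move=> /(QB _ _ Q0); rewrite sub0r.
have QD x y : Q x -> Q y -> Q (x + y) by move=> Qx /QN /(QB _ _ Qx); rewrite opprK.
have Qn x m : Q x -> Q (x *+ m).
  by move=> Qx; elim: m => [|m IH]; rewrite ?mulr0n // mulrS; apply: QD.
have -> : M *m z = \sum_j z j 0 *: col j M.
  apply/matrixP => i l; rewrite ord1 !mxE summxE; apply: eq_bigr => j _.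
  by rewrite !mxE mulrC.
apply: (big_ind Q) => // j _.
case: (z j 0) => m; last rewrite NegzE scaleNr; rewrite -natz scaler_nat.
  exact: Qn.
exact/QN/Qn.
Qed.

(** The vectors a - a0 and the columns of L span a lattice P Z^d, read off from a Smith form. If
    |det P| = 1 it is all of Z^d; otherwise A - a0 is divisible by P, and L = P N gives L P = P L'
    with L' = N P. *)
Lemma primitive_or_divisible L A a0 : \det L != 0 -> a0 \in A -> primitive L A \/
  exists P L' B, [/\ (1 < `|\det P|)%N, L *m P = P *m L' & A = sumset [fset a0] (mulmx P @` B)].
Proof.
move=> L0 a0A; set n := #|` A|.
pose MA : 'M[int]_(d, n) := \matrix_(i, j) (nth 0 (enum_fset A) j - a0) i 0.
pose M := row_mx MA L.
have [U UU [W WU [s _ eM]]] := int_Smith_normal_form M.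
(* The rectangular identity: M = P I W, and I has a right inverse, so P and M span the same
   lattice. *)
pose I : 'M[int]_(d, n + d) := \matrix_(i, j) ((i == j :> nat)%:R).
pose e : 'rV[int]_d := \row_i s`_i.
pose P := U *m diag_mx e.
have eM1 : M = P *m (I *m W).
  rewrite eM mulmxA; congr (_ *m _); rewrite /P -mulmxA; congr (_ *m _).
  by apply/matrixP => i j; rewrite mul_diag_mx !mxE mulr_natr.
have II : I *m I^T = 1%:M.
  apply/matrixP => i j; rewrite !mxE.
  have lt : (i < n + d)%N by apply: ltn_addl.
  rewrite (bigD1 (Ordinal lt)) //= big1 ?addr0 => [|l ne]; rewrite !mxE /= ?eqxx ?mul1r.
    by rewrite [in LHS]eq_sym.
  have /negPf-> : i != l :> nat by apply: contraNneq ne => il; apply/eqP/val_inj.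
  by rewrite mul0r.
have eP : P = M *m (invmx W *m I^T).
  by rewrite eM1 -!mulmxA (mulKVmx WU) II mulmx1.
have eL : L = P *m (I *m W *m col_mx 0 1%:M).
  by rewrite mulmxA -eM1 mul_row_col mulmx0 mulmx1 add0r.
have P0 : \det P != 0.
  by apply: contraNneq L0 => P0; rewrite eL det_mulmx P0 mul0r.
have colA j : exists2 a, a \in A & col j MA = a - a0.
  exists (nth 0 (enum_fset A) j); first by apply: mem_nth.
  by apply/matrixP => i l; rewrite ord1 !mxE.
have [leP1|ltP] := leqP `|\det P| 1.
  left=> Q QB QL QA x.
  have Q0 : Q 0 by rewrite -(subrr (L *m 0)); apply: QB.
  have PU : P \in unitmx.
    rewrite unitmxE; have : (`|\det P| = 1)%N by move: leP1 P0; rewrite -absz_gt0; lia.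
    by case: (\det P) => [[|[|]]|[|]].
  rewrite -(mulKVmx PU x) eP -mulmxA; apply: subgroup_mulmx => // j.
  case: (split_ordP j) => j' ->.
    by rewrite colKl; have [a aA ->] := colA j'; apply: QA.
  by rewrite colKr colE; apply: QL.
right; exists P, (I *m W *m col_mx 0 1%:M *m P).
have divA a : a \in A -> exists b, a - a0 = P *m b.
  move=> aA; have ia : (index a (enum_fset A) < n)%N by rewrite index_mem.
  exists (I *m W *m delta_mx (lshift d (Ordinal ia)) 0).
  rewrite mulmxA -eM1 -colE colKl; apply/matrixP => i l; rewrite ord1 !mxE nth_index //.
have divA' (a : V) : exists b : V, a \in A -> a - a0 = P *m b.
  by have [/divA[b ?]|_] := boolP (a \in A); [exists b | exists 0].
have [f fP] := choice divA'.
exists (f @` A); split=> //; first by rewrite mulmxA -eL.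
apply/fsetP => x; apply/idP/sumsetP => [xA|].
  exists a0, (P *m f x); split; rewrite ?fset11 //; first by do 2!apply: in_imfset.
  by rewrite -fP // addrC subrK.
move=> [_ [_ [/fset1P-> /imfsetP[_ /= /imfsetP[a /= aA ->] ->] ->]]].
by rewrite -fP // addrC subrK.
Qed.

Lemma kry_conj L L' P t : L *m P = P *m L' -> kry L (P *m t) = P *m kry L' t.
Proof.
move=> LP; apply/matrixP => i j; rewrite !mxE.
have -> : iter j (mulmx L) (P *m t) = P *m iter j (mulmx L') t.
  by elim: (j : nat) => //= m ->; rewrite !mulmxA LP.
by rewrite mxE; apply: eq_bigr => l _; rewrite !mxE.
Qed.

(** Replacing A = a0 + PB by B and L by its conjugate under P preserves the cardinalities and the
    determinant of L. It divides the non-zero integer [\det (kry L (a1 - a0))] by det P, of absolute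
    value at least 2, so the process ends, with a primitive set. *)
Lemma normalise L A : irred L -> \det L != 0 -> (1 < #|` A|)%N ->
  exists L' A', [/\ irred L', \det L' = \det L, #|` A'| = #|` A|,
    #|` sumset A' (mulmx L' @` A')| = #|` sumset A (mulmx L @` A)| & primitive L' A'].
Proof.
move=> irrL L0 A1.
have [a0 [a1 [a0A a1A ne]]] : exists a0 a1, [/\ a0 \in A, a1 \in A & a1 - a0 != 0].
  have /fset0Pn[a0 a0A] : A != fset0 by rewrite -cardfs_gt0; apply: ltnW.
  have /fset0Pn[a1] : A `\ a0 != fset0.
    by rewrite -cardfs_gt0; move: A1; rewrite (cardfsD1 a0 A) a0A.
  by rewrite !inE => /andP[ne a1A]; exists a0, a1; rewrite subr_eq0.
have [m] := ubnP (`|\det (kry L (a1 - a0))|).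
elim: m L A a0 a1 irrL L0 {A1} a0A a1A ne => // m IH L A a0 a1 irrL L0 a0A a1A ne ltm.
have [prim|[P [L' [B [P1 LP eA]]]]] := primitive_or_divisible L0 a0A.
  by exists L, A.
have P0 : \det P != 0 by rewrite -absz_gt0; apply: ltnW.
have eL' : \det L' = \det L.
  by have /(congr1 determinant) := LP; rewrite !det_mulmx mulrC => /(mulfI P0).
have irrL' : irred L'.
  move=> t t0; have := irrL (P *m t); rewrite (kry_conj _ LP) det_mulmx mulf_eq0 negb_or P0.
  by apply; apply: contra t0 => /eqP e; apply/eqP/(mulmx_inj P0); rewrite e mulmx0.
have L'0 : \det L' != 0 by rewrite eL'.
have inB a : a \in A -> exists2 b, b \in B & a = a0 + P *m b.
  rewrite eA => /sumsetP[_ [_ [/fset1P-> /imfsetP[b /= bB ->] ->]]]; by exists b.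
have [b0 b0B e0] := inB _ a0A; have [b1 b1B e1] := inB _ a1A.
have eb : a1 - a0 = P *m (b1 - b0).
  by rewrite e1 {2}e0 mulmxBr opprD addrACA subrr add0r.
have neb : b1 - b0 != 0 by apply: contraNneq ne => e; rewrite eb e mulmx0.
have ltb : (`|\det (kry L' (b1 - b0))| < m)%N.
  move: ltm; rewrite eb (kry_conj _ LP) det_mulmx abszM.
  have := irrL' _ neb; rewrite -absz_gt0.
  move: P1; move: `|\det P|%N `|\det (kry _ _)|%N => p x p1 x0 ltpx.
  have : (2 * x <= p * x)%N by rewrite leq_mul2r p1 orbT.
  by move: ltpx; rewrite ltnS; lia.
have [L'' [A' [h1 h2 h3 h4 h5]]] := IH L' B b0 b1 irrL' L'0 b0B b1B neb ltb.
exists L'', A'; split=> //; rewrite ?h2 // ?h3 ?h4 eA.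
  by rewrite card_translate card_inj_imfset //; apply: mulmx_inj.
rewrite imfset_sumset sumsetACA imfset_fset1.
have -> : sumset [fset a0] [fset L *m a0] = [fset a0 + L *m a0].
  apply/fsetP => x; rewrite inE; apply/sumsetP/eqP => [[a [b [/fset1P-> /fset1P-> ->]]] //|->].
  by exists a0, (L *m a0); rewrite !fset11.
rewrite card_translate -imfset_comp (_ : (mulmx L \o mulmx P) @` B = mulmx P @` (mulmx L' @` B)).
  by rewrite -imfset_sumset card_inj_imfset //; apply: mulmx_inj.
by rewrite -imfset_comp; apply: eq_imfset => // x /=; rewrite !mulmxA LP.
Qed.

End Normalisation.

(** * Periodicity modulo the image lattice *)

Section Periodicity.
Variable d : nat.
Local Notation V := 'cV[int]_d.
Variables (L : 'M[int]_d) (rep : V -> V) (Rp : {fset V}).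
Hypothesis L0 : \det L != 0.
Hypothesis HR : coset_reps L rep Rp.
Implicit Types A B : {fset V}.

Lemma repP x y : rep x = rep y <-> exists z, x = y + L *m z.
Proof.
split=> [e|[z ->]]; last by rewrite (rep_shift HR).
have [u eu] := rep_eq HR x; have [v ev] := rep_eq HR y.
by exists (u - v); rewrite {1}eu {1}ev e mulmxBr addrA addrAC addrK.
Qed.

Lemma rep_add x y z : rep x = rep y -> rep (x + z) = rep (y + z).
Proof. by move=> /repP[u ->]; apply/repP; exists u; rewrite addrAC. Qed.

Lemma rep_mulrn_det x v : rep (x + v *+ `|\det L|) = rep x.
Proof.
apply/repP.
have e : L *m (\adj L *m v) = \det L *: v by rewrite mulmxA mul_mx_adj mul_scalar_mx.
have pos m : Posz m *: v = v *+ m by rewrite -scaler_nat natz.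
case: (\det L) e => m e.
  by exists (\adj L *m v); rewrite e pos.
by exists (- (\adj L *m v)); rewrite mulmxN e NegzE scaleNr opprK pos.
Qed.

(** Let J be the union of the cosets met by B. By hypothesis each a - r maps J into itself; so the
    periods of J contain A - A and L Z^d, and by primitivity they are all of Z^d. *)
Lemma periodic_full A B r : primitive L A -> cls rep A r = sumset [fset r] (mulmx L @` B) ->
  B != fset0 ->
  (forall x a, x \in B -> a \in A -> exists2 y, y \in B & rep (x + a) = rep (y + r)) ->
  forall r', r' \in Rp -> cls rep B r' != fset0.
Proof.
move=> prim eA B0 per.
pose J x := exists2 y, y \in B & rep y = rep x.
have Jrep x y : rep x = rep y -> J x -> J y by move=> e [z zB ez]; exists z; rewrite // ez.
have fwd a x : a \in A -> J x -> J (x + (a - r)).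
  move=> aA [y yB ey]; have [z zB ez] := per y a yB aA; exists z => //.
  rewrite addrA -(rep_add (- r) (rep_add a ey)) (rep_add (- r) ez).
  by rewrite addrK.
have fwdn a m x : a \in A -> J x -> J (x + (a - r) *+ m).
  move=> aA Jx; elim: m => [|m IH]; first by rewrite mulr0n addr0.
  by rewrite mulrSr addrA; apply: fwd.
pose Q v := forall x, J x <-> J (x + v).
have QB x y : Q x -> Q y -> Q (x - y).
  move=> Qx Qy z; split=> Jz.
    have : J (z - y) by apply/Qy; rewrite subrK.
    by move/Qx; rewrite addrAC addrA.
  by rewrite -(subrK y z); apply/(Qy (z - y))/(Qx (z - y)); rewrite addrAC -addrA.
have QL y : Q (L *m y).
  by move=> x; split; apply: Jrep; rewrite (rep_shift HR).
(* The shift by a - r has finite order modulo L Z^d, so one step back amounts to |det L| - 1 steps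
   forward. *)
have Qr a : a \in A -> Q (a - r).
  move=> aA x; split; first exact: fwd.
  move=> /(fwdn a `|\det L|.-1 _ aA); rewrite -addrA -mulrS prednK ?absz_gt0 //.
  by apply: Jrep; apply: rep_mulrn_det.
have Qall x : Q x.
  apply: (prim Q QB QL) => a b aA bA; have -> : a - b = (a - r) - (b - r) by rewrite opprB addrA subrK.
  by apply: QB; apply: Qr.
move=> r' r'R; have [b bB] := fset0Pn _ B0.
have : J r'.
  by have [+ _] := Qall (r' - b) b; rewrite addrC subrK; apply; exists b.
by move=> [y yB ey]; apply/fset0Pn; exists y; rewrite in_cls yB ey (rep_fix HR) ?eqxx.
Qed.

(** With A' the class of a, the translate r + Lx + LA' lies in A_r + LA. A common point with A_r + L
    A_r would give x + a = y + r modulo L Z^d for some y in B, so its |A'| points are extra. *)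
Lemma aperiodic_gain A B r x a : cls rep A r = sumset [fset r] (mulmx L @` B) ->
  x \in B -> a \in A -> (forall y, y \in B -> rep (x + a) != rep (y + r)) ->
  (#|` sumset (cls rep A r) (mulmx L @` cls rep A r)| + #|` cls rep A (rep a)| <=
   #|` sumset (cls rep A r) (mulmx L @` A)|)%N.
Proof.
move=> eA xB aA ne; pose a' := r + L *m x.
have a'A : a' \in cls rep A r by rewrite eA mem_sumset ?fset11 // in_imfset.
rewrite -(card_inj_imfset (cls rep A (rep a)) (mulmx_inj L0)).
rewrite -(card_translate a' (mulmx L @` cls rep A (rep a))).
rewrite -cardfsUI (_ : _ `&` _ = fset0) ?cardfs0 ?addn0.
  apply: fsubset_leq_card; rewrite fsubUset; apply/andP; split; apply: sumsetS.
  - exact: fsubset_refl.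
  - by apply: subset_imfset; apply/fsubsetP/cls_sub.
  - by rewrite fsub1set.
  - by apply: subset_imfset; apply/fsubsetP/cls_sub.
apply/eqP/fset0Pn => -[z /fsetIP[]].
move=> /sumsetP[u [v [uA vA ez]]] /sumsetP[u' [v' [/fset1P eu' v'A ez']]].
move: uA; rewrite eA => /sumsetP[r0 [w [/fset1P er0 /imfsetP[y /= yB ew] eu]]].
move: vA v'A => /imfsetP[b bA' ev] /imfsetP[a1 a1A' ev'].
have bA : b \in cls rep A r := bA'; have a1A : a1 \in cls rep A (rep a) := a1A'.
move: ez'; rewrite ez eu er0 ew ev eu' ev' /a' -!addrA -!mulmxDr => /addrI /(mulmx_inj L0) e.
move: bA a1A; rewrite !in_cls => /andP[_ /eqP br] /andP[_ /eqP a1a].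
have br' : rep b = rep r by rewrite -br (rep_fix HR (rep_in HR b)).
move: (ne y yB); rewrite (addrC x) -(rep_add x a1a) addrC -e.
by rewrite addrC (rep_add y br') addrC eqxx.
Qed.

(** If one class were all of A, then A - A would lie in L Z^d, and primitivity would force L Z^d =
    Z^d. This lets the induction hypothesis be applied to classes. *)
Lemma primitive_cls_proper A r : primitive L A -> (1 < `|\det L|)%N ->
  (#|` cls rep A r| < #|` A|)%N.
Proof.
move=> prim k1; rewrite ltn_neqAle fsubset_leq_card ?cls_sub // andbT.
apply: contraL k1 => /eqP e.
have eA : cls rep A r = A.
  by apply/eqP; rewrite eqEfcard cls_sub e /=.
have all0 : forall x, rep x = rep 0.
  apply: prim => [x y|y|a b].
  - by move=> ex ey; rewrite (rep_add (- y) ex) -(rep_add (- y) ey) subrr.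
  - by rewrite -[L *m y]add0r (rep_shift HR).
  - rewrite -eA !in_cls => /andP[_ /eqP ea] /andP[_ /eqP eb].
    by rewrite -ea in eb; rewrite -(rep_add (- b) eb) subrr.
rewrite -leqNgt -(rep_card HR); apply: (@leq_trans #|` [fset rep 0]|); last by rewrite cardfs1.
by apply/fsubset_leq_card/fsubsetP => x xR; rewrite inE -(rep_fix HR xR) all0.
Qed.

End Periodicity.

(** In a linear relation among t, Lt, ..., L^(d-1) t, the last vector with non-zero coefficient, L^m
    t, is a combination of the earlier ones. Their span is then invariant, contains t and has
    dimension at most m < d. *)
Lemma irreducible_irred d (L : 'M[int]_d) :
  ~ has_nontrivial_inv_subspace L -> irred L.
Proof.
move=> irr t t0; apply/negP => det0; apply: irr.
pose f := mulmx (matQ L) : 'cV[rat]_d -> 'cV[rat]_d.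
pose T j : 'cV[rat]_d := map_mx intr (iter j (mulmx L) t).
have TS j : f (T j) = T j.+1 by rewrite /f /T /= map_mxM.
have /det0P[v v0 vK] : \det (map_mx intr (kry L t) : 'M[rat]_d)^T == 0.
  by rewrite det_tr det_map_mx (eqP det0).
have sumT : \sum_j v 0 j *: T j = 0.
  apply/matrixP => i l; rewrite ord1 summxE [RHS]mxE.
  have /matrixP/(_ 0 i) := vK; rewrite !mxE => eK; rewrite -{}[RHS]eK.
  by apply: eq_bigr => j _; rewrite !mxE.
have [j0 vj0] : exists j, v 0 j != 0.
  apply/existsP; apply: contraR v0; rewrite negb_exists => /forallP v0.
  by apply/eqP/matrixP => i j; rewrite ord1 mxE; apply/eqP; rewrite -[_ == _]negbK v0.
have [m vm mmax] := @arg_maxnP _ j0 (fun j => v 0 j != 0) (fun j => j : nat) vj0.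
pose W : {vspace 'cV[rat]_d} := <<[seq T j | j <- iota 0 m]>>%VS.
have TW j : (j < m)%N -> T j \in W.
  by move=> jm; apply/memv_span/map_f; rewrite mem_iota.
have TmW : T m \in W.
  have : v 0 m *: T m \in W.
    move: sumT; rewrite (bigD1 m) //= => /eqP; rewrite addr_eq0 => /eqP ->.
    rewrite rpredN; apply: memv_suml => j jm.
    have [->|vj] := eqVneq (v 0 j) 0; first by rewrite scale0r mem0v.
    by apply/memvZ/TW; rewrite ltn_neqAle jm; apply: mmax.
  by move=> /(memvZ (v 0 m)^-1); rewrite scalerA mulVf // scale1r.
have T0W : T 0%N \in W by have [m0|/TW//] := posnP m; move: TmW; rewrite m0.
exists W; split.
- apply: contraNneq t0 => W0.
  move: T0W; rewrite W0 memv0 => /eqP/matrixP T0; apply/eqP/matrixP => i l.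
  by have /eqP := T0 i l; rewrite !mxE intr_eq0 => /eqP.
- apply: contraTneq (ltn_ord m) => Wf; rewrite -leqNgt.
  have := dim_span [seq T j | j <- iota 0 m]; rewrite -/W Wf dimvf size_map size_iota.
  by rewrite /dim /= muln1.
move=> u uW; have : linfun f u \in (linfun f @: W)%VS by apply: memv_img.
rewrite lfunE /= limg_span; apply/subvP/span_subvP => w /mapP[w' /mapP[j]].
rewrite mem_iota => /= jm -> ->; rewrite lfunE /= -/(f (T j)) TS.
have [->//|jm'] := eqVneq j.+1 m.
by apply: TW; rewrite ltn_neqAle jm'.
Qed.

(** * The induction *)

Section Exponents.
Variable R : realType.
Implicit Types t eta s sg n N : R.

Lemma small_exponent t eta s : 0 < t -> t < 1 -> 0 < eta -> 0 < s ->
  exists sg, [/\ 0 < sg, sg <= s & t `^ (- sg) <= 1 + eta].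
Proof.
move=> t0 t1 eta0 s0.
have lt : 0 < - ln t by rewrite oppr_gt0 ln_lt0 // t0.
have le : 0 < ln (1 + eta) by rewrite ln_gt0 // ltrDl.
exists (Num.min s (ln (1 + eta) / - ln t)); split.
- by rewrite lt_min s0 divr_gt0.
- by rewrite ge_min lexx.
rewrite /powR gt_eqF // -[leRHS]lnK ?posrE ?addr_gt0 // ler_expR mulNr -mulrN.
by rewrite -ler_pdivlMr // ge_min lexx orbT.
Qed.

Lemma powR_split N sg : 0 < N -> N `^ (1 - sg) = N * N `^ (- sg).
Proof. by move=> N0; rewrite powRD ?powRr1 ?(ltW N0) // (gt_eqF N0) implybT. Qed.

(** At the price of a factor 1 + eta the concave n^(1 - sg) is replaced by a bound linear in n,
    which can be summed over classes. *)
Lemma powR_shrink t eta sg n N : 0 < t -> 0 < N -> t * N <= n -> 0 < sg ->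
  t `^ (- sg) <= 1 + eta -> n `^ (1 - sg) <= (1 + eta) * N `^ (- sg) * n.
Proof.
move=> t0 N0 tn sg0 te; have n0 : 0 < n by apply: lt_le_trans tn; apply: mulr_gt0.
rewrite powR_split // mulrC ler_wpM2r ?(ltW n0) //.
apply: (@le_trans _ _ ((t * N) `^ (- sg))).
  rewrite !powRN lef_pV2 ?posrE ?powR_gt0 ?mulr_gt0 //.
  by apply: ge0_ler_powR; rewrite ?nnegrE //; apply: ltW => //; apply: mulr_gt0.
by rewrite (powRM _ (ltW t0) (ltW N0)) ler_wpM2r ?powR_ge0.
Qed.

End Exponents.

Section Step.
Variables (R : realType) (d k : nat) (kap : R).
Hypothesis d0 : (0 < d)%N.
Hypothesis kap0 : 0 < kap.
Hypothesis kapE : kap ^+ d = k%:R.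
Local Notation V := 'cV[int]_d.
Implicit Types (L : 'M[int]_d) (A B X : {fset V}).
Let c : R := (1 + kap) ^+ d.
Local Notation def := (defect kap).
Variables (K : nat) (E s : R).
Hypothesis cK : c <= K%:R.
Hypothesis E0 : 0 < E.
Hypothesis s1 : s < 1.
Hypothesis HBM : forall L A X (x y : R), irred L -> \det L != 0 ->
  X `<=` A -> X != fset0 -> (#|` sumset A (mulmx L @` A)| <= K * #|` A|)%N ->
  0 <= x -> 0 <= y -> x ^+ d <= #|` X|%:R -> y ^+ d <= #|` A|%:R ->
  (x + y) ^+ d <= #|` sumset X (mulmx L @` A)|%:R + E * #|` A|%:R `^ (1 - s).

(** [tau] is the proportion of |A| below which a non-empty class counts as small, [1 + eta] the loss
    from concavity, and [rho] the contraction factor of [full_defect]. *)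
Variables (D sg eta tau : R).
Let rho : R := (c / k%:R) / (1 + c / k%:R).
Hypothesis D0 : 0 < D.
Hypothesis sg0 : 0 < sg.
Hypothesis sgs : sg <= s.
Hypothesis eta0 : 0 < eta.
Hypothesis tau0 : 0 < tau.
Hypothesis ctau : c * tau <= 2^-1.
Hypothesis tsg : (tau / k%:R) `^ (- sg) <= 1 + eta.
Hypothesis ceta1 : c * eta <= 2^-1.
Hypothesis ceta2 : c * eta <= tau.
Hypothesis Dlarge : rho * D * (1 + eta) + k%:R * (k%:R * E) <= D.

(** Each class contributes at most [h r] to the defect, and the [h r] add up to 1 + eta times the
    target. The excess is recovered in one of three ways: from a small non-empty class, from the
    contraction factor on every class, or from a class that gains an extra translate. *)
Lemma defect_step L A : irred L -> `|\det L|%N = k -> (1 < k)%N -> (1 < #|` A|)%N ->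
  primitive L A ->
  (forall B, (#|` B| < #|` A|)%N -> def L B <= D * #|` B|%:R `^ (1 - sg)) ->
  def L A <= D * #|` A|%:R `^ (1 - sg).
Proof.
move=> irrL detk k1 A1 prim IH.
have L0 : \det L != 0 by rewrite -absz_gt0 detk; apply: ltnW.
have [rep [Rp HR]] := coset_reps_exist L0.
set N : R := #|` A|%:R; set P := N `^ (1 - sg).
have N0 : 0 < N by rewrite ltr0n; apply: ltnW.
have N1 : 1 <= N by rewrite ler1n; apply: ltnW.
have k0 : (0 : R) < k%:R by rewrite ltr0n; apply: ltnW.
have k1R : (1 : R) <= k%:R by rewrite ler1n; apply: ltnW.
have c00 : 0 < c := slope_gt0 d kap0.
have P0 : 0 < P by apply: powR_gt0.
have PE : P = N * N `^ (- sg) by apply: powR_split.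
pose n r : R := #|` cls rep A r|%:R.
pose S r : R := #|` sumset (cls rep A r) (mulmx L @` A)|%:R.
have n0 r : 0 <= n r by apply: ler0n.
have defE : def L A = \sum_(r <- Rp) (c * n r - S r).
  rewrite /defect (card_sum_cls HR) (card_cls HR A) !natr_sum mulr_sumr.
  by rewrite sumrB.
have sumn : \sum_(r <- Rp) n r = N by rewrite /N (card_cls HR A) natr_sum.
(* The defect is at most c N, so D P < c N may be assumed; the excess eta D P is then at most c eta
   N, and a gain of that size on a single class suffices. *)
have [triv|nontriv] := leP (c * N) (D * P).
  apply: le_trans triv; rewrite /defect -/c -/N gerBl; exact: ler0n.
have gain g : c * eta * N <= g -> D * (1 + eta) * P - g <= D * P.
  move=> hg; rewrite mulrDr mulr1 mulrDl -addrA gerDl subr_le0; apply: le_trans hg.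
  by rewrite (mulrAC D) (mulrAC c) ler_wpM2r ?(ltW eta0) ?(ltW nontriv).
have IHr r : def L (cls rep A r) <= D * n r `^ (1 - sg).
  by apply: IH; apply: (primitive_cls_proper HR) => //; rewrite detk.
have Sdef r : c * n r - S r <= def L (cls rep A r).
  rewrite /defect -/c -/(n r) lerB // ler_nat; apply: card_sumsetS; apply: subset_imfset.
  by apply/fsubsetP/cls_sub.
pose h r := D * (1 + eta) * N `^ (- sg) * n r.
have eta10 : 0 < 1 + eta by apply: addr_gt0.
have h0 r : 0 <= h r by rewrite !mulr_ge0 ?powR_ge0 ?(ltW D0) ?(ltW eta10).
have sumh : \sum_(r <- Rp) h r = D * (1 + eta) * P.
  by rewrite -mulr_sumr sumn PE -!mulrA (mulrC N).
have shr (m : R) : tau / k%:R * N <= m -> m `^ (1 - sg) <= (1 + eta) * N `^ (- sg) * m.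
  by move=> hm; apply: powR_shrink tsg => //; apply: divr_gt0.
have tk : tau / k%:R <= tau by rewrite ler_pdivrMr // ler_peMr // ltW.
have Dshr r : tau * N <= n r -> D * n r `^ (1 - sg) <= h r.
  move=> hr; rewrite /h -!mulrA ler_wpM2l ?(ltW D0) // mulrA; apply: shr.
  by apply: le_trans hr; rewrite ler_wpM2r // ltW.
have Sge r : cls rep A r != fset0 -> N <= S r.
  move=> /fset0Pn[a aA]; rewrite ler_nat sumsetC.
  have <- := card_inj_imfset A (mulmx_inj L0); exact: card_sumset_ge aA.
have Ssmall r : cls rep A r != fset0 -> n r < tau * N -> c * n r - S r <= - (N / 2).
  move=> /Sge hS /ltW hn; have := ler_wpM2l (ltW c00) hn.
  have := ler_wpM2r (ltW N0) ctau; rewrite mulrA; lra.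
have Sempty r : cls rep A r = fset0 -> c * n r - S r <= 0.
  by move=> e; rewrite /n e cardfs0 mulr0 sub0r oppr_le0 ler0n.
have term r : c * n r - S r <= h r.
  have [/Sempty hS|ne] := eqVneq (cls rep A r) fset0; first exact: le_trans hS _.
  have [hr|hr] := leP (tau * N) (n r).
    by apply: le_trans (Sdef r) _; apply: le_trans (IHr r) _; apply: Dshr.
  apply: le_trans (Ssmall r ne hr) _; apply: le_trans (h0 r).
  by rewrite oppr_le0 divr_ge0 // ltW.
have conclude r0 g : r0 \in Rp -> c * eta * N <= g -> c * n r0 - S r0 <= h r0 - g ->
    def L A <= D * P.
  move=> r0R hg hr0; apply: le_trans (gain g hg).
  rewrite defE -sumh (big_fsetD1 r0) //= [in leRHS](big_fsetD1 r0) //= [leRHS]addrAC.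
  by apply: lerD => //; apply: ler_sum => r _; apply: term.
have [[r0 [r0R ne small]]|allbig] :=
    pselect (exists r0, [/\ r0 \in Rp, cls rep A r0 != fset0 & n r0 < tau * N]).
  apply: (conclude r0 (N / 2)) => //.
    by rewrite mulrC ler_wpM2l // ltW.
  by apply: le_trans (Ssmall r0 ne small) _; rewrite lerDr.
have big r : r \in Rp -> cls rep A r != fset0 -> tau * N <= n r.
  by move=> rR ne; rewrite leNgt; apply/negP => hr; apply: allbig; exists r.
(* The contracted bound for one class; if every class obeys it, [Dlarge] gives the claim. *)
pose bound3 r := rho * h r + k%:R * (E * N `^ (1 - s)).
have rho0 : 0 <= rho by rewrite /rho divr_ge0 ?addr_ge0 ?divr_ge0 ?ler01 // ltW.
have bound30 r : 0 <= bound3 r.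
  apply: addr_ge0; first exact: mulr_ge0.
  by rewrite !mulr_ge0 ?powR_ge0 ?(ltW k0) ?(ltW E0).
have [[r0 [r0R not3]]|all3] :=
    pselect (exists r0, r0 \in Rp /\ ~ (c * n r0 - S r0 <= bound3 r0)); last first.
  have le3 r : r \in Rp -> c * n r - S r <= bound3 r.
    by move=> rR; apply: contrapT => h3; apply: all3; exists r.
  apply: (@le_trans _ _ (\sum_(r <- Rp) bound3 r)).
    by rewrite defE big_seq [leRHS]big_seq; apply: ler_sum.
  rewrite big_split /= -mulr_sumr sumh big_const_seq count_predT iter_addr_0.
  rewrite (rep_card HR) detk -[X in _ + X <= _]mulr_natl.
  apply: (@le_trans _ _ ((rho * D * (1 + eta) + k%:R * (k%:R * E)) * P)); last first.
    by rewrite ler_wpM2r // ltW.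
  rewrite mulrDl; apply: lerD; first by rewrite !mulrA.
  rewrite -!mulrA; do 3!(apply: ler_wpM2l; first exact: ltW).
  by rewrite ler_powR // lerB.
have ne0 : cls rep A r0 != fset0.
  by apply/negP => /eqP /Sempty hS; apply: not3; apply: le_trans hS _.
have [B eB] := cls_dilate HR A r0.
have nB : n r0 = #|` B|%:R by rewrite /n eB card_dilate.
have B0 : B != fset0.
  by rewrite -cardfs_gt0 -(ltr_nat R) -nB ltr_nat cardfs_gt0.
have [per|notper] := pselect (forall x a, x \in B -> a \in A ->
    exists2 y, y \in B & rep (x + a) = rep (y + r0)).
  (* In the periodic case B meets every coset and has the same defect as the class of r0, so
     [full_defect] for B contradicts the choice of r0. *)
  case: not3; apply: le_trans (Sdef r0) _.
  have full := periodic_full L0 HR prim eB B0 per.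
  have -> : def L (cls rep A r0) = def L B.
    by rewrite /defect {1}eB card_dilate // eB card_sum_dilate.
  pose b r := D * #|` cls rep B r|%:R `^ (1 - sg) : R.
  have ltB : (#|` B| < #|` A|)%N.
    rewrite -(ltr_nat R) -nB ltr_nat; apply: (primitive_cls_proper HR) => //.
    by rewrite detk.
  have := full_defect d0 kap0 kapE cK E0 HBM irrL L0 detk HR full (b := b).
  move=> /(_ _ _) /le_trans; apply.
  - by move=> r _; rewrite mulr_ge0 ?powR_ge0 // ltW.
  - move=> r rR _; apply: IH; apply: leq_ltn_trans ltB.
    exact/fsubset_leq_card/cls_sub.
  apply: lerD; last first.
    rewrite !ler_wpM2l ?(ltW k0) ?(ltW E0) //.
    by apply: ge0_ler_powR; rewrite ?nnegrE ?subr_ge0 ?(ltW s1) ?ler0n // ler_nat ltnW.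
  rewrite -/rho ler_wpM2l //.
  have nbig := big r0 r0R ne0.
  apply: (@le_trans _ _ (\sum_(r <- Rp | #|` B|%:R <= k%:R * #|` cls rep B r|%:R :> R)
      D * (1 + eta) * N `^ (- sg) * #|` cls rep B r|%:R)).
    (* A large class of B has at least |B| / k >= (tau / k) N points, which explains the ratio in
       [tsg]. *)
    apply: ler_sum => r hr; rewrite /b -!mulrA ler_wpM2l ?(ltW D0) // mulrA; apply: shr.
    rewrite mulrAC ler_pdivrMr // (mulrC _ k%:R); apply: le_trans hr.
    by rewrite -nB.
  rewrite -mulr_sumr /h ler_wpM2l //; last first.
    have sB : #|` B|%:R = \sum_(r <- Rp) #|` cls rep B r|%:R :> R.
      by rewrite {1}(card_cls HR B) natr_sum.
    rewrite nB [leRHS]sB [leRHS](bigID (fun r =>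
      #|` B|%:R <= k%:R * #|` cls rep B r|%:R :> R)) /= lerDl.
    by apply: sumr_ge0 => r _; apply: ler0n.
  by rewrite !mulr_ge0 ?powR_ge0 ?(ltW D0) ?(ltW eta10).
have [x [a [xB aA ne]]] : exists x a, [/\ x \in B, a \in A &
    forall y, y \in B -> rep (x + a) != rep (y + r0)].
  apply: contrapT => no; apply: notper => x a xB aA; apply: contrapT => no2.
  apply: no; exists x, a; split=> // y yB; apply/eqP => e; apply: no2; by exists y.
have := aperiodic_gain L0 HR eB xB aA ne; rewrite -(ler_nat R) natrD => hg.
have al : a \in cls rep A (rep a) by rewrite in_cls aA eqxx.
have nl : tau * N <= n (rep a).
  by apply: big; [apply: rep_in HR _ | apply/fset0Pn; exists a].
apply: (conclude r0 (tau * N)) => //; first by rewrite ler_wpM2r // ltW.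
have := IHr r0; have := Dshr r0 (big r0 r0R ne0); rewrite /defect -/c -/(n r0).
move: hg nl; rewrite -/(S r0) -/(n (rep a)); lra.
Qed.

End Step.

(** The constants are fixed before L and A. The induction on |A| runs over all admissible L at once,
    because normalisation changes L. *)
Lemma defect_bound (R : realType) (d k : nat) (kap : R) :
  (0 < d)%N -> 0 < kap -> kap ^+ d = k%:R ->
  exists D sg : R, [/\ 0 < D, 0 < sg & forall (L : 'M[int]_d) (A : {fset 'cV[int]_d}),
    irred L -> `|\det L|%N = k -> defect kap L A <= D * #|` A|%:R `^ (1 - sg)].
Proof.
move=> d0 kap0 kapE; pose c : R := (1 + kap) ^+ d.
have k0 : (0 : R) < k%:R := index_gt0 kap0 kapE.
have k1 : (1 : R) <= k%:R by rewrite ler1n -(ltr0n R).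
have c1 : 1 <= c by rewrite exprn_ege1 // lerDl ltW.
have c00 : 0 < c by apply: lt_le_trans c1.
pose K := Num.bound c.
have cK : c <= K%:R by apply/ltW/archi_boundP/ltW.
have [E [s [E0 s0 s1 HBM]]] := dilate_BM R d K.
pose C := c / k%:R; have C0 : 0 < C by apply: divr_gt0.
pose rho := C / (1 + C).
have C10 : 0 < 1 + C by apply: addr_gt0.
have rho0 : 0 <= rho by rewrite divr_ge0 ?ltW.
have rho1 : rho < 1 by rewrite ltr_pdivrMr // mul1r ltrDr.
pose tau : R := (2 * c)^-1.
have tau0 : 0 < tau by rewrite invr_gt0 mulr_gt0.
have ctau : c * tau = 2^-1 by rewrite /tau; field; rewrite gt_eqF.
(* The first two bounds make the gains N / 2 and tau N sufficient; the third makes rho (1 + eta) at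
   most (1 + rho) / 2. *)
pose eta : R := Num.min (2 * c)^-1 (Num.min (tau / c) ((1 - rho) / 2)).
have eta0 : 0 < eta by rewrite !lt_min tau0 !divr_gt0 // subr_gt0.
have etaL x : eta <= x -> c * eta <= c * x by move=> h; rewrite ler_wpM2l // ltW.
have ceta1 : c * eta <= 2^-1 by rewrite -ctau; apply: etaL; rewrite ge_min lexx.
have ceta2 : c * eta <= tau.
  apply: (le_trans (etaL (tau / c) _)); first by rewrite !ge_min lexx orbT.
  by rewrite mulrCA divff ?mulr1 // gt_eqF.
have eta3 : eta <= (1 - rho) / 2 by rewrite !ge_min lexx !orbT.
have tau1 : tau / k%:R < 1.
  rewrite ltr_pdivrMr // mul1r; apply: lt_le_trans k1.
  by rewrite invf_lt1 ?mulr_gt0 //; lra.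
have [sg [sg0 sgs tsg]] := small_exponent (divr_gt0 tau0 k0) tau1 eta0 s0.
(* The summand c settles one-point sets, E the case k = 1, and the last summand yields [Dlarge]. *)
pose D := c + E + 2 * (k%:R * (k%:R * E)) / (1 - rho).
have rho10 : 0 < 1 - rho by rewrite subr_gt0.
have D3 : 0 <= 2 * (k%:R * (k%:R * E)) / (1 - rho).
  by rewrite !mulr_ge0 ?invr_ge0 // ltW.
have D0 : 0 < D by rewrite /D; lra.
have Dlarge : rho * D * (1 + eta) + k%:R * (k%:R * E) <= D.
  have h1 : k%:R * (k%:R * E) <= D * ((1 - rho) / 2).
    have -> : k%:R * (k%:R * E) = 2 * (k%:R * (k%:R * E)) / (1 - rho) * ((1 - rho) / 2).
      by field; rewrite gt_eqF.
    by rewrite ler_wpM2r ?divr_ge0 ?(ltW rho10) // /D; lra.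
  have h2 : rho * D * (1 + eta) <= D * ((1 + rho) / 2).
    have -> : rho * D * (1 + eta) = D * (rho + rho * eta) by ring.
    rewrite ler_wpM2l ?(ltW D0) //.
    have : rho * eta <= 1 * eta by rewrite ler_wpM2r // ltW.
    by move: eta3; lra.
  apply: le_trans (lerD h2 h1) _.
  by rewrite -mulrDr (_ : (1 + rho) / 2 + (1 - rho) / 2 = 1) ?mulr1 //; field.
exists D, sg; split=> // L A irrL detk.
have [n] := ubnP #|` A|; elim: n L A irrL detk => // n IH L A irrL detk; rewrite ltnS => ltn.
have P0 : 0 <= (#|` A|%:R : R) `^ (1 - sg) by apply: powR_ge0.
have [A1|A1] := leqP #|` A| 1.
  rewrite /defect lerBlDr ler_wpDr ?ler0n //.
  case: #|` A| A1 P0 => [|[|//]] _ P0; first by rewrite mulr0; apply: mulr_ge0 (ltW D0) P0.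
  by rewrite powR1 !mulr1 /D -/c; lra.
have L0 : \det L != 0 by rewrite -absz_gt0 detk -(ltr0n R).
have [k2|k2] := ltnP 1 k.
  have [L' [A' [irrL' detL' cA' cS' prim]]] := normalise irrL L0 A1.
  have -> : defect kap L A = defect kap L' A' by rewrite /defect cA' cS'.
  have detk' : `|\det L'|%N = k by rewrite detL'.
  have ctau' : c * tau <= 2^-1 by rewrite ctau.
  rewrite -cA'; apply: (defect_step d0 kap0 kapE cK E0 s1 HBM D0 sg0 sgs eta0 tau0 ctau'
    tsg ceta1 ceta2 Dlarge) => //; rewrite ?cA' //.
  by move=> B ltB; apply: IH => //; apply: leq_trans ltB ltn.
(* For k = 1 there is a single class, and [class_bounds] with X = A bounds the defect directly. *)
have {}k2 : k%:R = 1 :> R by apply/eqP; rewrite eq_le k1 lern1 k2.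
have [def0|def0] := leP (defect kap L A) 0.
  by apply: le_trans def0 _; rewrite mulr_ge0 // ltW.
have A0 : A != fset0 by rewrite -cardfs_gt0; apply: ltnW.
have [+ _] := class_bounds d0 kap0 kapE cK HBM irrL L0 (fsubset_refl A) A0 def0.
rewrite k2 mul1r subrr addr0 => /(_ (lexx _)) le.
apply: (@le_trans _ _ (E * #|` A|%:R `^ (1 - s))).
  by rewrite /defect lerBlDl.
apply: ler_pM; rewrite ?powR_ge0 ?(ltW E0) //; first by rewrite /D; lra.
by rewrite ler_powR ?lerB // ler1n ltnW.
Qed.

(** * From the defect to the stated inequality *)

Lemma sum_dilE d (L : 'M[int]_d) (A : {fset 'cV[int]_d}) :
  sum_dil L A = sumset A (mulmx L @` A).
Proof.
apply/fsetP => x; apply/imfset2P/sumsetP => [[a aA [b bA ->]]|].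
  by exists a, (L *m b); rewrite in_imfset.
move=> [a [_ [aA /imfsetP[b /= bA ->] ->]]].
by exists a => //; exists b.
Qed.

Lemma card_sum_dil_ge d (L : 'M[int]_d) (A : {fset 'cV[int]_d}) :
  (#|` A| <= #|` sum_dil L A|)%N.
Proof.
rewrite sum_dilE; have [->|/fset0Pn[a aA]] := eqVneq A fset0; first by rewrite cardfs0.
by apply: (@card_sumset_ge _ _ _ (L *m a)); rewrite in_imfset.
Qed.

Local Open Scope ring_scope.
Local Open Scope fset_scope.

Theorem theorem3p4 (R : realType) (d k : nat) :
  exists D2 sigma2 : R, 0 < D2 /\ 0 < sigma2 /\
    forall (L : 'M[int]_d),
      ~ has_nontrivial_inv_subspace L ->
      `|\det L|%N = k ->
      forall A : {fset 'cV[int]_d},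
        ((1 + (k%:R : R) `^ (d%:R^-1)) ^+ d * (#|` A|)%:R
           - D2 * ((#|` A|)%:R : R) `^ (1 - sigma2)
         <= (#|` sum_dil L A|)%:R).
Proof.
(* For d = 0 or k = 0 the coefficient of |A| is 1, and |A + LA| >= |A| is enough. *)
have trivial_bound (z : R) : z <= 1 -> exists D2 sigma2 : R, 0 < D2 /\ 0 < sigma2 /\
    forall (L : 'M[int]_d) (A : {fset 'cV[int]_d}),
      z * #|` A|%:R - D2 * (#|` A|%:R : R) `^ (1 - sigma2) <= #|` sum_dil L A|%:R.
  move=> z1; exists 1, 1; do 2!split=> //; move=> L A.
  apply: (@le_trans _ _ #|` A|%:R); last by rewrite ler_nat card_sum_dil_ge.
  rewrite lerBlDr ler_wpDr ?mulr_ge0 ?powR_ge0 //.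
  by rewrite -{2}[#|` A|%:R]mul1r ler_wpM2r.
have [d0|d0] := posnP d.
  have [|D [s [D0 [s0 H]]]] := trivial_bound ((1 + (k%:R : R) `^ (d%:R^-1)) ^+ d).
    by rewrite d0 expr0.
  by exists D, s; do 2!split=> //; move=> L _ _ A; apply: H.
have [k0|k0] := posnP k.
  have [|D [s [D0 [s0 H]]]] := trivial_bound ((1 + (k%:R : R) `^ (d%:R^-1)) ^+ d).
    by rewrite k0 powR0 ?addr0 ?expr1n // invr_eq0 pnatr_eq0 -lt0n.
  by exists D, s; do 2!split=> //; move=> L _ _ A; apply: H.
set kap := (k%:R : R) `^ _.
have kap0 : 0 < kap by rewrite powR_gt0 // ltr0n.
have kapE : kap ^+ d = k%:R.
  by rewrite -powR_mulrn ?(ltW kap0) // -powRrM mulVf ?powRr1 // pnatr_eq0 -lt0n.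
have [D [sg [D0 sg0 H]]] := defect_bound d0 kap0 kapE.
exists D, sg; do 2!split=> //; move=> L irr detk A.
have := H L A (irreducible_irred irr) detk.
by rewrite /defect sum_dilE; lra.
Qed.
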